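(* If a tournament $H$ is regular, then it satisfies the Erdős–Hajnal Conjecture: there exists $\epsilon(H)>0$ such that every tournament $T$ not containing $H$ as a subtournament contains a transitive subtournament on at least $|T|^{\epsilon(H)}$ vertices.
   Context: Tournaments are finite; subtournament = induced subtournament; transitive = no directed cycle; $tr(T)$ = maximum size of a transitive subtournament of $T$. $V_1$ is complete to $V_2$ if every vertex of $V_1$ has an edge to every vertex of $V_2$. For disjoint nonempty $X,Y$, $d(X,Y)=e_{X,Y}/(|X||Y|)$, $e_{X,Y}$ = number of edges $(x,y)$ with $x\in X,y\in Y$. For a $\{0,1\}$-vector $v$ of length $m$, $\zeta^v(i)=|\{j\le i:v(j)=1\}|$; $\eta$ is a vector of positive integers of length $\zeta^v(m)$; $k=|\{j:v(j)=0\}|+\sum_i\eta(i)$. For a tournament $T$, $c>0$, $0\le\lambda<1$, a $(v,\eta,c,\lambda)$-m-sequence in $T$ is a sequence $\chi=(S_1,\dots,S_m)$ of pairwise disjoint subsets of $V(T)$ such that: if $v(i)=1$, $S_i$ induces a transitive subtournament partitioned into $S_{i,1},\dots,S_{i,\eta(\zeta^v(i))}$ with $S_{i,a}$ complete to $S_{i,b}$ for $a<b$ and $|S_{i,a}|\ge c\,tr(T)$; if $v(i)=0$, $|S_i|\ge c|T|$; $d(S_i,S_j)\ge1-\lambda$ for $i<j$. Its long representation $l(\chi)=(T_1,\dots,T_k)$ replaces each $S_i$ with $v(i)=1$ by $S_{i,1},\dots,S_{i,\eta(\zeta^v(i))}$ in order; $V(\chi)=\bigcup S_i$. A $c'$-strong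 pair in $\chi$ is a pair $(A,B)$ of disjoint subsets of $V(\chi)$ with $|A|\ge c'|T|$, either $|B|\ge c'|T|$ or ($B$ transitive and $|B|\ge c'\,tr(T)$), and $d(A,B)=1$ or $d(B,A)=1$. For $\mathcal{H}=\{H_1,\dots,H_t\}$, $V(H_i)=\{h^i_1,\dots\}$, and $\mathcal{F}=\{f_1,\dots,f_t\}$ with $f_i:V(H_i)\to\{1,\dots,k\}$ injective, $\mathcal{H}$ has the $(\mathcal{F},v,\eta)$-strong EH-property if for every $c_1>0$ there exist $\lambda_0>0,c_2>0$ such that for every tournament $T$, $0\le\lambda\le\lambda_0$ and $(v,\eta,c_1,\lambda)$-m-sequence $\chi$ in $T$ with $l(\chi)=(T_1,\dots,T_k)$, either there are $i$ and $x_j\in T_{f_i(h^i_j)}$ with $x_j\mapsto h^i_j$ an isomorphism from the subtournament induced on $\{x_j\}$ onto $H_i$, or $\chi$ contains a $c_2$-strong pair. Products: an edge $(x,y)$ is backward under an ordering if $y$ precedes $x$. For tournaments $H_1,H_2$ with disjoint vertex sets and injective $f_1:V(H_1)\to\mathbb{N}$, $f_2:V(H_2)\to\mathbb{N}$ with $f_1(x)\ne f_2(y)$ for all $x,y$ ($\langle f_1,f_2\rangle=0$), let $\theta_i$ order $V(H_i)$ by increasing $f_i$ and $\theta$ order $V(H_1)\cup V(H_2)$ by increasing value of $f_1$ on $V(H_1)$ and $f_2$ on $V(H_2)$. $H_1^{f_1}\oplus H_2^{f_2}$ is the tournament on $V(H_1)\cup V(H_2)$ whose backward edges under $\theta$ are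 exactly those of $H_1$ under $\theta_1$ and those of $H_2$ under $\theta_2$. For $\mathcal{F}=\{f_1,\dots,f_r\}$, $\mathcal{G}=\{g_1,\dots,g_s\}$ with $\langle f,g\rangle=0$ for all $f\in\mathcal{F},g\in\mathcal{G}$, $\mathcal{H}_1^{\mathcal{F}}\oplus\mathcal{H}_2^{\mathcal{G}}=\{H_{1,i}^{f_i}\oplus H_{2,j}^{g_j}\}$; if one of the two families is empty, the product is taken to be the other family. A tournament $H$ is regular if there exist vectors $v,\eta$, a family $\mathcal{H}_1$ with the $(\mathcal{F},v,\eta)$-strong EH-property and a family $\mathcal{H}_2$ with the $(\mathcal{G},v,\eta)$-strong EH-property (one of $\mathcal{H}_1,\mathcal{H}_2$ may be empty; vertex sets of members of $\mathcal{H}_1$ disjoint from those of $\mathcal{H}_2$; $\langle f,g\rangle=0$ for all $f\in\mathcal{F},g\in\mathcal{G}$) such that $\mathcal{H}_1^{\mathcal{F}}\oplus\mathcal{H}_2^{\mathcal{G}}$ is a nonempty family each member of which contains $H$ as a subtournament. *)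

(* Defs.v *)
From HB Require Import structures.
From mathcomp Require Import all_boot all_order all_algebra.
From mathcomp Require Import boolp reals exp.

Set Implicit Arguments.
Unset Strict Implicit.
Unset Printing Implicit Defensive.

Import Order.TTheory GRing.Theory Num.Theory.
Local Open Scope ring_scope.

Record tournament := Tournament {
  vertex :> finType;
  arc : rel vertex;
  arc_irr : irreflexive arc;
  arc_tot : forall x y, x != y -> arc y x = ~~ arc x y }.

Definition acyclic (T : tournament) (A : {set T}) : Prop :=
  forall c : seq T, c != [::] -> uniq c -> {subset c <= A} -> ~~ cycle (@arc T) c.

Definition tr (T : tournament) : nat :=
  \max_(A : {set T} | `[< acyclic A >]) #|A|.

Definition complete_to (T : tournament) (A B : {set T}) : Prop :=
  {in A & B, forall x y, arc x y}.

(* Junk value 0 when A or B is empty. *)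
Definition density (R : realType) (T : tournament) (A B : {set T}) : R :=
  #|[set p : T * T | [&& p.1 \in A, p.2 \in B & arc p.1 p.2]]|%:R
    / (#|A| * #|B|)%:R.

(* x is an isomorphism from H onto the subtournament of T induced on its image *)
Definition embedding (H T : tournament) (x : {ffun H -> T}) : bool :=
  injectiveb x && [forall a, forall b, arc (x a) (x b) == arc a b].

Definition contains (T H : tournament) : bool :=
  [exists x : {ffun H -> T}, embedding x].

(* Indices are 0-based throughout: zeta v n counts the ones among the first n
   entries of v, so the entry of eta attached to a position i : 'I_m with
   v(i) = 1 has 0-based index zeta v i. *)
Definition zeta (m : nat) (v : m.-tuple bool) (n : nat) : nat :=
  count id (take n v).

Section MSequences.
Variables (m : nat) (v : m.-tuple bool) (eta : (zeta v m).-tuple nat).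

Definition long_length : nat := (count negb v + \sum_(a <- eta) a)%N.

Definition block_size (i : 'I_m) : nat :=
  if tnth v i then nth 0%N eta (zeta v i) else 1%N.

(* The i-th entry of a sequence chi is the list [S_{i,1}; ...; S_{i,r}] of the
   parts of S_i when v(i) = 1, and the one-element list [S_i] when v(i) = 0:
   the ordered partitions belong to chi since the long representation
   depends on them. *)
Definition blocks (T : tournament) := m.-tuple (seq {set T}).

Definition block (T : tournament) (chi : blocks T) (i : 'I_m) : {set T} :=
  \bigcup_(A <- tnth chi i) A.

Definition long_rep (T : tournament) (chi : blocks T) : seq {set T} :=
  flatten chi.

Definition support (T : tournament) (chi : blocks T) : {set T} :=
  \bigcup_(i < m) block chi i.

Record m_sequence (R : realType) (T : tournament) (c lambda : R)
    (chi : blocks T) : Prop := MSequence {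
  mseq_c : 0 < c;
  mseq_lambda : 0 <= lambda < 1;
  mseq_size : forall i, size (tnth chi i) = block_size i;
  mseq_disjoint : forall i j : 'I_m, i != j ->
    [disjoint block chi i & block chi j];
  mseq_transitive : forall i, tnth v i -> acyclic (block chi i);
  mseq_part : forall i, tnth v i -> forall a, (a < size (tnth chi i))%N ->
    c * (tr T)%:R <= #|nth set0 (tnth chi i) a|%:R;
  mseq_partition : forall i, tnth v i ->
    forall a b, (a < b < size (tnth chi i))%N ->
    [disjoint nth set0 (tnth chi i) a & nth set0 (tnth chi i) b] /\
    complete_to (nth set0 (tnth chi i) a) (nth set0 (tnth chi i) b);
  mseq_linear : forall i, ~~ tnth v i -> c * #|T|%:R <= #|block chi i|%:R;
  mseq_density : forall i j : 'I_m, (i < j)%N ->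
    1 - lambda <= density R (block chi i) (block chi j) }.

Definition strong_pair (R : realType) (T : tournament) (c' : R)
    (chi : blocks T) (A B : {set T}) : Prop :=
  [/\ A :|: B \subset support chi, [disjoint A & B],
      c' * #|T|%:R <= #|A|%:R,
      c' * #|T|%:R <= #|B|%:R \/ (acyclic B /\ c' * (tr T)%:R <= #|B|%:R)
    & density R A B = 1 \/ density R B A = 1].

End MSequences.

(* A tournament H together with an injective f : V(H) -> {0, ..., k-1}. *)
Record labelled (k : nat) := Labelled {
  underlying :> tournament;
  label : underlying -> 'I_k;
  label_inj : injective label }.

(* A family {H_1, ..., H_t} and its labellings {f_1, ..., f_t} are given
   together, as X : 'I_t -> labelled k.  Nonemptiness of T makes all the
   densities that occur meaningful: T nonempty and c1, c2 > 0 force the blocks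
   of chi and both members of a strong pair to be nonempty. *)
Definition strong_EH (R : realType) (m : nat) (v : m.-tuple bool)
    (eta : (zeta v m).-tuple nat) (t : nat)
    (X : 'I_t -> labelled (long_length eta)) : Prop :=
  forall c1 : R, 0 < c1 ->
  exists lambda0 c2 : R, [/\ 0 < lambda0, 0 < c2 &
    forall (T : tournament) (lambda : R) (chi : blocks m T),
      (0 < #|T|)%N -> 0 <= lambda <= lambda0 ->
      m_sequence eta c1 lambda chi ->
      (exists (i : 'I_t) (x : {ffun X i -> T}),
          (forall h, x h \in nth set0 (long_rep chi) (label h)) /\
          embedding x)
      \/ (exists A B : {set T}, strong_pair c2 chi A B)].

(* Usually written <f, g> = 0 for the labellings f of X and g of Y. *)
Definition orthogonal (k : nat) (X Y : labelled k) : Prop :=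
  forall (x : X) (y : Y), label x <> label y.

Definition backward (k : nat) (X : labelled k) : rel X :=
  fun x y => arc x y && (label y < label x)%N.
Arguments backward {k} X.

Section Product.
Variables (k : nat) (X Y : labelled k).

Definition prod_label (u : X + Y) : 'I_k :=
  match u with inl x => label x | inr y => label y end.

Definition prod_backward (u w : X + Y) : bool :=
  match u, w with
  | inl x, inl x' => backward X x x'
  | inr y, inr y' => backward Y y y'
  | _, _ => false
  end.

(* A pair is an arc when it is forward and its reversal is not prescribed to be
   backward, or when it is itself prescribed to be backward. *)
Definition prod_arc (u w : X + Y) : bool :=
  if (prod_label u < prod_label w)%N then ~~ prod_backward w u
  else prod_backward u w.

Lemma prod_backwardW u w :
  prod_backward u w -> (prod_label w < prod_label u)%N.
Proof. by case: u w => [x|y] [x'|y'] //= /andP[]. Qed.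

Lemma prod_arc_irr : irreflexive prod_arc.
Proof.
by move=> u; rewrite /prod_arc ltnn; apply/negP => /prod_backwardW; rewrite ltnn.
Qed.

Hypothesis oXY : orthogonal X Y.

Lemma prod_label_inj : injective prod_label.
Proof.
case=> [x|y] [x'|y'] /= E.
- by rewrite (label_inj E).
- by case: (oXY E).
- by case: (oXY (esym E)).
- by rewrite (label_inj E).
Qed.

Lemma prod_arc_tot u w : u != w -> prod_arc w u = ~~ prod_arc u w.
Proof.
rewrite /prod_arc -(inj_eq prod_label_inj) -val_eqE /=.
by case: ltngtP; rewrite ?negbK.
Qed.

Definition oplus : tournament := Tournament prod_arc_irr prod_arc_tot.

(* The backward edges of the product are exactly those of the two factors. *)
Lemma oplus_backward (u w : oplus) :
  arc u w && (prod_label w < prod_label u)%N = prod_backward u w.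
Proof.
rewrite /= /prod_arc; case: ltngtP => // h; rewrite ?andbT ?andbF //;
  by apply/esym/negbTE/negP => /prod_backwardW; rewrite ?h ?ltnn // ltnNge ltnW.
Qed.

End Product.

(* The sum type X i + Y j makes the vertex sets of the factors disjoint. *)
Definition family_prod (k s t : nat) (X : 'I_s -> labelled k)
    (Y : 'I_t -> labelled k) (o : forall i j, orthogonal (X i) (Y j)) :
    seq tournament :=
  if s == 0%N then [seq underlying (Y j) | j <- enum 'I_t]
  else if t == 0%N then [seq underlying (X i) | i <- enum 'I_s]
  else [seq oplus (o i j) | i <- enum 'I_s, j <- enum 'I_t].

(* An empty family carries no requirement: the product is then the other
   family alone. *)
Definition regular (R : realType) (H : tournament) : Prop :=
  exists (m : nat) (v : m.-tuple bool) (eta : (zeta v m).-tuple nat) (s t : nat)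
    (X : 'I_s -> labelled (long_length eta))
    (Y : 'I_t -> labelled (long_length eta))
    (o : forall i j, orthogonal (X i) (Y j)),
    [/\ all (fun a => 0 < a)%N eta,
        s = 0%N \/ strong_EH R X,
        t = 0%N \/ strong_EH R Y,
        family_prod o <> [::]
      & all (fun P => contains P H) (family_prod o)].

Definition satisfies_EH (R : realType) (H : tournament) : Prop :=
  exists2 eps : R, 0 < eps &
    forall T : tournament, ~~ contains T H ->
      exists2 A : {set T}, acyclic A & #|T|%:R `^ eps <= #|A|%:R.

(* Main.v *)
(* A minimal counterexample with a tiny exponent is critical: every subset of
   linear size contains an acyclic subset of almost maximal size tr T, so there
   is no strong pair.  An H-free critical T contains m-sequences (embed H
   greedily to find one pair of linear sets with nearly all arcs forward,
   iterate, and pass to acyclic subsets of low-degree halves).  In the strong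
   EH-property lambda0 depends on c1, so the constant c1 must not depend on
   lambda: this is arranged by choosing the linear sets of equal size and
   replacing T by the subtournament induced on their union, which is again
   critical.  The sequences are built so that every single vertex has few
   backward neighbours in every other block; after finding a copy of a member
   of H1, one therefore keeps at least half of every part by deleting the
   vertices that are not forward to the copy, and a copy of a member of H2 in
   what remains completes a copy of the product. *)

Require Import Defs.
From mathcomp Require Import all_boot all_order all_algebra.
From mathcomp Require Import boolp reals exp.
From mathcomp Require Import zify.
(* [arc] would otherwise denote [path.arc]. *)
Import Defs.


Set Implicit Arguments.
Unset Strict Implicit.
Unset Printing Implicit Defensive.

Import Order.TTheory GRing.Theory Num.Theory.

(** * Acyclic sets and induced subtournaments *)

Lemma arc_asym (T : tournament) (x y : T) : arc x y -> arc y x = false.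
Proof.
move=> xy; have [E|ne] := eqVneq x y; last by rewrite arc_tot // xy.
by rewrite E arc_irr in xy.
Qed.

(** A failure of transitivity closes a directed triangle; conversely, transitivity contracts any
    directed cycle to a loop. *)
Lemma acyclicP (T : tournament) (A : {set T}) :
  acyclic A <-> {in A & &, transitive (@arc T)}.
Proof.
split=> [acA y x z yA xA zA xy yz|trA [//|x p] _ _ sA].
  apply/negPn/negP=> nxz.
  have xney : x != y by apply: contraTneq xy => ->; rewrite arc_irr.
  have ynez : y != z by apply: contraTneq yz => ->; rewrite arc_irr.
  have xnez : x != z.
    by apply: contraTneq yz => <-; rewrite (arc_asym xy).
  have zx : arc z x by rewrite arc_tot.
  have /negP[] : ~~ cycle (@arc T) [:: x; y; z].
    apply: acA => //=; first by rewrite !inE negb_or xney xnez ynez.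
    by move=> u; rewrite !inE => /or3P[]/eqP->.
  by rewrite /= xy yz zx.
have sxp : all (mem A) (x :: p) by apply/allP.
have sxpx : all (mem A) (x :: rcons p x).
  by move: sxp => /= /andP[xA pA]; rewrite all_rcons /= xA.
by apply/negP=> /= /(order_path_min_in trA sxpx); rewrite all_rcons arc_irr.
Qed.

Lemma acyclicS (T : tournament) (A B : {set T}) :
  B \subset A -> acyclic A -> acyclic B.
Proof. by move=> sBA acA c c0 uc cB; apply: acA => // x /cB /(subsetP sBA). Qed.

Lemma acyclic0 (T : tournament) : acyclic (set0 : {set T}).
Proof. by apply/acyclicP=> y x z; rewrite inE. Qed.

Lemma acyclic1 (T : tournament) (x : T) : acyclic [set x].
Proof.
by apply/acyclicP=> y z t; rewrite !inE => /eqP-> /eqP-> /eqP->; rewrite arc_irr.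
Qed.

Lemma complete_to_disjoint (T : tournament) (A B : {set T}) :
  complete_to A B -> [disjoint A & B].
Proof.
move=> cAB; apply/pred0P=> x /=; apply/negP=> /andP[xA xB].
by have := cAB _ _ xA xB; rewrite arc_irr.
Qed.

Lemma acyclicU (T : tournament) (A B : {set T}) :
  complete_to A B -> acyclic A -> acyclic B -> acyclic (A :|: B).
Proof.
move=> cAB /acyclicP trA /acyclicP trB; apply/acyclicP=> y x z.
rewrite !inE => /orP yAB /orP xAB /orP zAB xy yz.
case: xAB zAB => [xA|xB] [zA|zB]; last 1 first.
- case: yAB => [yA|yB]; last exact: trB yB xB zB xy yz.
  by rewrite (arc_asym (cAB _ _ yA xB)) in xy.
- case: yAB => [yA|yB]; first exact: trA yA xA zA xy yz.
  by rewrite (arc_asym (cAB _ _ zA yB)) in yz.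
- exact: cAB.
case: yAB => [yA|yB]; first by rewrite (arc_asym (cAB _ _ yA xB)) in xy.
by rewrite (arc_asym (cAB _ _ zA yB)) in yz.
Qed.

Arguments acyclicS [T A B].
Arguments acyclic0 T : clear implicits.
Arguments acyclic1 [T] x.
Arguments acyclicU [T A B].

Lemma leq_tr (T : tournament) (A : {set T}) : acyclic A -> #|A| <= tr T.
Proof. by move=> acA; apply: leq_bigmax_cond; apply/asboolP. Qed.

Lemma tr_witness (T : tournament) : exists2 A : {set T}, acyclic A & #|A| = tr T.
Proof.
have [|A /asboolP acA E] := @eq_bigmax_cond _
  (fun A : {set T} => `[< acyclic A >]) (fun A => #|A|); last by exists A.
by apply/card_gt0P; exists set0; apply/asboolP/acyclic0.
Qed.

(** The out- or the in-neighbourhood of any vertex [x] of [A] carries at least half of the remaining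
    vertices; recurse there and add [x]. *)
Lemma acyclic_log (T : tournament) (q : nat) (A : {set T}) :
  2 ^ q <= #|A| -> exists B : {set T}, [/\ B \subset A, acyclic B & q < #|B|].
Proof.
elim: q A => [|q IH] A leA.
  have /card_gt0P[x xA] : 0 < #|A| by [].
  by exists [set x]; rewrite sub1set cards1; split=> //; apply: acyclic1.
have /card_gt0P[x xA] : 0 < #|A| by apply: leq_trans leA; rewrite expn_gt0.
pose O := [set y in A | arc x y]; pose I := [set y in A | arc y x].
have E : #|A| <= 1 + (#|O| + #|I|).
  apply: (@leq_trans #|[set x] :|: (O :|: I)|).
    apply/subset_leq_card/subsetP=> y yA; rewrite !inE yA /=.
    by case: eqVneq => //= ne; rewrite (arc_tot ne) orNb.
  apply: leq_trans (leq_card_setU _ _) _; rewrite cards1 leq_add2l.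
  exact: leq_card_setU.
have [hO|hI] : 2 ^ q <= #|O| \/ 2 ^ q <= #|I|.
  by rewrite expnS in leA; case: (leqP (2 ^ q) #|O|) => h; [left|right; lia].
- have [B [BO acB lB]] := IH _ hO.
  have cB : complete_to [set x] B.
    by move=> u y /set1P-> /(subsetP BO); rewrite inE => /andP[].
  exists ([set x] :|: B); split; last 1 first.
  + by rewrite cardsU (disjoint_setI0 (complete_to_disjoint cB)) cards0 cards1; lia.
  + rewrite subUset sub1set xA; apply: subset_trans BO _.
    by apply/subsetP=> y; rewrite inE => /andP[].
  + exact: acyclicU cB (acyclic1 x) acB.
- have [B [BI acB lB]] := IH _ hI.
  have cB : complete_to B [set x].
    by move=> y u yB /set1P->; move/(subsetP BI): yB; rewrite inE => /andP[].
  exists (B :|: [set x]); split; last 1 first.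
  + by rewrite cardsU (disjoint_setI0 (complete_to_disjoint cB)) cards0 cards1; lia.
  + rewrite subUset sub1set xA andbT; apply: subset_trans BI _.
    by apply/subsetP=> y; rewrite inE => /andP[].
  + exact: acyclicU cB acB (acyclic1 x).
Qed.

Lemma contains_trans (T U H : tournament) :
  contains T U -> contains U H -> contains T H.
Proof.
move=> /existsP[x /andP[/injectiveP ix /forallP ex]].
move=> /existsP[y /andP[/injectiveP iy /forallP ey]].
apply/existsP; exists [ffun h => x (y h)]; apply/andP; split.
  by apply/injectiveP=> a b; rewrite !ffunE => /ix /iy.
apply/forallP=> a; apply/forallP=> b; rewrite !ffunE.
by rewrite (eqP (forallP (ex _) _)) (eqP (forallP (ey _) _)).
Qed.

(** Injectivity comes for free: distinct vertices are joined by an arc, which a common image would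
    send to a loop. *)
Lemma containsP (T H : tournament) :
  (exists x : H -> T, forall a b, arc (x a) (x b) = arc a b) -> contains T H.
Proof.
move=> [x ex]; apply/existsP; exists [ffun h => x h]; apply/andP; split.
  apply/injectiveP=> a b; rewrite !ffunE => E; apply/eqP/negPn/negP=> ne.
  by have := arc_tot ne; rewrite -!ex E arc_irr.
by apply/forallP=> a; apply/forallP=> b; rewrite !ffunE ex.
Qed.

Section Induced.
Variables (T : tournament) (W : {set T}).

Definition induced_arc (a b : {x : T | x \in W}) : bool := arc (val a) (val b).

Lemma induced_arc_irr : irreflexive induced_arc.
Proof. by move=> a; apply: arc_irr. Qed.

Lemma induced_arc_tot x y : x != y -> induced_arc y x = ~~ induced_arc x y.
Proof. by move=> ne; apply: arc_tot. Qed.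

Definition induced : tournament := Tournament induced_arc_irr induced_arc_tot.

Definition trace (A : {set T}) : {set induced} := [set x | val x \in A].

Lemma sum_trace (A : {set T}) (F : T -> nat) : A \subset W ->
  \sum_(x in trace A) F (val x) = \sum_(x in A) F x.
Proof.
move=> sAW; rewrite -(big_imset _ (in2W val_inj)) /=.
apply: eq_bigl => x; apply/imsetP/idP => [[u]|xA].
  by rewrite inE => uA ->.
by exists (exist _ x (subsetP sAW _ xA)); rewrite ?inE.
Qed.

Lemma card_trace (A : {set T}) : A \subset W -> #|trace A| = #|A|.
Proof. by move=> sAW; rewrite -!sum1_card; apply: (sum_trace (fun=> 1)). Qed.

Lemma card_induced : #|induced| = #|W|.
Proof.
rewrite -(card_trace (subxx W)) -cardsT; congr #|pred_of_set _|.
by apply/setP=> x; rewrite !inE (valP x).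
Qed.

Lemma acyclic_trace (A : {set T}) : acyclic A -> acyclic (trace A).
Proof.
move=> /acyclicP trA; apply/acyclicP=> y x z.
by rewrite !inE; apply: trA.
Qed.

Lemma acyclic_val (A : {set induced}) : acyclic A -> acyclic (val @: A).
Proof.
move=> /acyclicP trA; apply/acyclicP=> y' x' z'.
by move=> /imsetP[y yA ->] /imsetP[x xA ->] /imsetP[z zA ->]; apply: (trA y x z).
Qed.

Lemma contains_induced : contains T induced.
Proof. by apply: containsP; exists val. Qed.

End Induced.
Arguments acyclic_trace [T W A].
Arguments acyclic_val [T W A].

(** * Sparse pairs in H-free tournaments *)

Lemma card_setIdE (U : finType) (A : {set U}) (P : pred U) :
  #|[set x in A | P x]| = \sum_(x in A) P x.
Proof.
rewrite -sum1_card big_mkcond [RHS]big_mkcond; apply: eq_bigr => x _.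
by rewrite inE; case: (x \in A) => //=; case: (P x).
Qed.

Lemma leq_card_bigcup (U : finType) (I : Type) (r : seq I) (P : pred I)
    (Z : I -> {set U}) :
  #|\bigcup_(i <- r | P i) Z i| <= \sum_(i <- r | P i) #|Z i|.
Proof.
elim/big_rec2: _ => [|i n B _ IH]; first by rewrite cards0.
by apply: leq_trans (leq_card_setU _ _) _; rewrite leq_add2l.
Qed.

Lemma leq_sum_subset (U : finType) (A B : {set U}) (F : U -> nat) :
  A \subset B -> \sum_(x in A) F x <= \sum_(x in B) F x.
Proof. by move=> sAB; rewrite [leqRHS](big_setID A) (setIidPr sAB) leq_addr. Qed.

Section Chunk.
Variables (U : finType) (N : nat) (s : seq U).

(** Cuts [s] into consecutive windows: an arbitrary order gives disjoint sets of prescribed size, an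
    order along the arcs gives the parts of a transitive set. *)
Definition chunk (i : nat) : {set U} := [set x in s | index x s %/ N == i].

Lemma chunk_index i j x y :
  x \in chunk i -> y \in chunk j -> i < j -> index x s < index y s.
Proof.
rewrite !inE => /andP[_ /eqP<-] /andP[_ /eqP<-].
by apply: contraTltn => h; rewrite -leqNgt leq_div2r.
Qed.

Lemma chunk_disjoint i j : i != j -> [disjoint chunk i & chunk j].
Proof.
move=> ne; apply/pred0P=> x /=; rewrite !inE.
by apply: contra_neqF ne => /andP[/andP[_ /eqP->] /andP[_ /eqP->]].
Qed.

Lemma card_chunk i : uniq s -> i.+1 * N <= size s -> N <= #|chunk i|.
Proof.
move=> us le; have lesz k : k < N -> i * N + k < size s.
  by move=> lk; apply: leq_trans le; rewrite mulSn addnC ltn_add2r.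
pose t := take N (drop (i * N) s).
have [->//|N0] := posnP N.
have st : size t = N.
  by rewrite size_takel // size_drop; move: le; rewrite mulSn; lia.
have ut : uniq t by rewrite take_uniq // drop_uniq.
rewrite -{1}st -(card_uniqP ut); apply/subset_leq_card/subsetP=> x xt.
have xs : x \in s by apply/mem_drop/mem_take/xt.
move: (xt) => /(nthP x)[k]; rewrite st => lk <-.
rewrite nth_take // nth_drop !inE mem_nth ?lesz //.
rewrite index_uniq ?lesz //.
by rewrite divnMDl // divn_small // addn0 eqxx.
Qed.

End Chunk.

Section Greedy.
Variables (H T : tournament) (t0 : T) (A : {set T}) (L q : nat).
Hypotheses (L1 : 1 < L) (q0 : 0 < q).
Hypothesis no_sparse_pair : forall X Y : {set T}, X \subset A -> Y \subset A ->
  [disjoint X & Y] -> q <= #|X| -> q <= #|Y| ->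
  #|X| * #|Y| < L * \sum_(x in X) \sum_(y in Y) (arc y x : nat).

(** The vertices of [H] are embedded one by one, [V u] being the candidates for [u]. As no pair of
    large sets is sparse in either direction, some [x] in [V u] keeps a fraction 1/L of the
    candidates for every remaining vertex. *)
Lemma greedy_embedding (s : seq H) (V : H -> {set T}) :
  uniq s -> {in s &, forall u w, u != w -> [disjoint V u & V w]} ->
  {in s, forall u, V u \subset A /\ q * L ^ size s <= #|V u|} ->
  exists x : H -> T, {in s, forall u, x u \in V u} /\
    {in s &, forall u w, arc (x u) (x w) = arc u w}.
Proof.
elim: s V => [|u s IH] V; first by move=> *; exists (fun=> t0).
move=> /= /andP[us uniqs] dV sV.
have memS w : w \in s -> w \in u :: s by rewrite inE => ->; rewrite orbT.
have uS : u \in u :: s by rewrite inE eqxx.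
have neu w : w \in s -> u != w by apply: contraTneq => <-.
pose N w x := [set y in V w | arc x y == arc u w].
(* [Z w] collects the choices for [u] that leave too few candidates for [w]. *)
pose Z w := [set x in V u | #|N w x| * L < #|V w|].
have qL : q <= q * L ^ (size s).+1 by rewrite leq_pmulr // expn_gt0; lia.
have qV w : w \in u :: s -> q <= #|V w|.
  by move=> /sV[_]; apply: leq_trans.
(* Otherwise [Z w] and [V w] form a sparse pair; the direction of the arc between [u] and [w]
   decides which of them comes first. *)
have Zq w : w \in s -> #|Z w| < q.
  move=> ws; rewrite ltnNge; apply/negP=> qZ.
  have dZ : [disjoint Z w & V w].
    apply: disjointWl (dV _ _ uS (memS _ ws) (neu _ ws)).
    by apply/subsetP=> x; rewrite inE => /andP[].
  have [VuA _] := sV _ uS; have [VwA leVw] := sV _ (memS _ ws).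
  have ZA : Z w \subset A.
    by apply: subset_trans VuA; apply/subsetP=> x; rewrite inE => /andP[].
  have le : L * \sum_(x in Z w) #|N w x| <= #|Z w| * #|V w|.
    rewrite big_distrr /= -sum_nat_const; apply: leq_sum => x.
    by rewrite inE mulnC => /andP[_ /ltnW].
  case: (boolP (arc u w)) => uw.
    have := no_sparse_pair VwA ZA; rewrite disjoint_sym => /(_ dZ).
    move=> /(_ (qV _ (memS _ ws)) qZ); apply/negP; rewrite -leqNgt.
    rewrite [leqRHS]mulnC exchange_big /=; apply: leq_trans le; rewrite leq_mul2l.
    apply/orP; right; apply: leq_sum => x xZ; rewrite card_setIdE.
    by apply: leq_sum => y _; rewrite uw eqb_id.
  have := no_sparse_pair ZA VwA dZ qZ (qV _ (memS _ ws)).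
  apply/negP; rewrite -leqNgt; apply: leq_trans le; rewrite leq_mul2l.
  apply/orP; right; apply: leq_sum => x xZ; rewrite card_setIdE.
  apply: leq_sum => y _; rewrite (negbTE uw) eqbF_neg.
  by case: (boolP (arc y x)) => // /arc_asym ->.
have [x xu xZ] : exists2 x, x \in V u & forall w, w \in s -> x \notin Z w.
  have : 0 < #|V u :\: \bigcup_(w <- s) Z w|.
    rewrite cardsD subn_gt0; apply: leq_ltn_trans (subset_leq_card (subsetIr _ _)) _.
    apply: leq_ltn_trans (leq_card_bigcup _ _ _) _.
    have [_ leVu] := sV _ uS; apply: leq_trans leVu.
    apply: (@leq_ltn_trans (\sum_(w <- s) q)).
      by rewrite big_seq [leqRHS]big_seq; apply: leq_sum => w /Zq /ltnW.
    rewrite big_const_seq count_predT iter_addn addn0 ltn_pmul2l //.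
    exact: ltn_trans (ltnSn _) (ltn_expl _ L1).
  move=> /card_gt0P[x]; rewrite inE => /andP[xZ xu]; exists x => // w ws.
  by apply: contra xZ => xZ; rewrite bigcup_seq; apply/bigcupP; exists w.
have [w w' ws w's|w ws|y [yN yarc]] := IH (fun w => N w x) uniqs.
- move=> ne; apply: disjointWl (disjointWr _ (dV w w' (memS _ ws) (memS _ w's) ne)).
    by apply/subsetP=> z; rewrite inE => /andP[].
  by apply/subsetP=> z; rewrite inE => /andP[].
- have [VwA leVw] := sV _ (memS _ ws); split.
    by apply: subset_trans VwA; apply/subsetP=> z; rewrite inE => /andP[].
  have := xZ w ws; rewrite inE xu /= -leqNgt => le.
  by have := leq_trans leVw le; rewrite /= expnSr mulnA leq_pmul2r // ltnW.
exists (fun w => if w == u then x else y w); split.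
  move=> w; rewrite inE; case: eqP => [->//|_] /= /yN.
  by rewrite inE => /andP[].
have xy w : w \in s -> arc x (y w) = arc u w.
  by move=> /yN; rewrite inE => /andP[_ /eqP].
move=> w w'; rewrite !inE; case: eqP => [->|_] /=; case: eqP => [->|_] //=.
- by rewrite !arc_irr.
- by move=> _ /xy.
- move=> ws _; rewrite arc_tot ?xy // -?arc_tot ?neu //.
  have := dV _ _ uS (memS _ ws) (neu _ ws) => /disjoint_setI0/setP/(_ x).
  rewrite !inE xu /=; apply: contraFneq => ->.
  by have := yN _ ws; rewrite inE => /andP[].
- exact: yarc.
Qed.

End Greedy.

(** Without a sparse pair, [greedy_embedding] would place a copy of [H] with one vertex in each of
    |H| disjoint chunks of [A]. *)
Lemma sparse_pair (H : tournament) (L : nat) : 1 < L ->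
  exists2 C : nat, 0 < C & forall (T : tournament) (A : {set T}),
    ~~ contains T H -> C <= #|A| ->
    exists X Y : {set T}, [/\ X \subset A /\ Y \subset A, [disjoint X & Y],
      #|A| <= C * #|X|, #|A| <= C * #|Y|
      & L * \sum_(x in X) \sum_(y in Y) (arc y x : nat) <= #|X| * #|Y|].
Proof.
(* The |H| chunks of size q L^|H| occupy q D vertices, where q is |A| / D rounded down; the factor 2
   pays for the rounding. *)
move=> L1; pose D := #|H| * L ^ #|H|; exists (2 * D).+1 => // T A TH CA.
apply: contrapT => nex; move/negP: TH; apply.
have [h0|h0] := posnP #|H|.
  have noH (h : H) : False by have := card0_eq h0 h; rewrite inE.
  by apply: containsP; exists (fun h => False_rect _ (noH h)) => a; case: (noH a).
have D0 : 0 < D by rewrite muln_gt0 h0 expn_gt0; lia.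
pose q := #|A| %/ D.
have q0 : 0 < q by rewrite divn_gt0 //; lia.
have Aq : #|A| <= 2 * D * q.
  by have := divn_eq #|A| D; have := ltn_pmod #|A| D0; rewrite -/q; nia.
have qA : q * D <= #|A| by apply: leq_trunc_div.
have [t0 _] : exists t0, t0 \in A by apply/card_gt0P; lia.
have Aq' B : q <= #|B| -> #|A| <= (2 * D).+1 * #|B|.
  by move=> qB; apply: leq_trans Aq _; apply: leq_mul.
have sp (X Y : {set T}) : X \subset A -> Y \subset A ->
  [disjoint X & Y] -> q <= #|X| -> q <= #|Y| ->
  #|X| * #|Y| < L * \sum_(x in X) \sum_(y in Y) (arc y x : nat).
  move=> XA YA dXY qX qY; rewrite ltnNge; apply/negP=> le; apply: nex.
  by exists X, Y; split=> //; apply: Aq'.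
pose V (u : H) := chunk (q * L ^ #|H|) (enum A) (enum_rank u).
have [||u _|x [_ ex]] := @greedy_embedding H T t0 A L q L1 q0 sp (enum H) V.
- exact: enum_uniq.
- move=> u w _ _ ne; apply: chunk_disjoint.
  by apply: contra ne => /eqP/val_inj/enum_rank_inj ->.
- split; first by apply/subsetP=> x; rewrite !inE mem_enum => /andP[].
  rewrite -cardE; apply: card_chunk; first exact: enum_uniq.
  rewrite -cardE; apply: leq_trans qA; rewrite /D mulnCA leq_mul2l; apply/orP; right.
  by rewrite leq_mul2r; apply/orP; right; apply: ltn_ord.
by apply: containsP; exists x => a b; apply: ex; rewrite mem_enum.
Qed.

(** * Sequences with few backward arcs *)

(* x in S_i and y in S_j are joined against the order of the indices; symmetric
   in the pairs (i, x) and (j, y) when i != j. *)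
Definition wrong (T : tournament) (i j : nat) (x y : T) : bool :=
  if i < j then arc y x else arc x y.

Definition wrong_degree (T : tournament) (i j : nat) (x : T) (B : {set T}) : nat :=
  \sum_(y in B) wrong i j x y.

Lemma wrong_sym (T : tournament) (i j : nat) (x y : T) :
  i != j -> wrong i j x y = wrong j i y x.
Proof. by rewrite /wrong; case: ltngtP. Qed.

Lemma wrong_degreeS (T : tournament) (i j : nat) (x : T) (A B : {set T}) :
  A \subset B -> wrong_degree i j x A <= wrong_degree i j x B.
Proof. exact: leq_sum_subset. Qed.

Definition quasi_forward (T : tournament) (m L : nat) (S : 'I_m -> {set T}) : Prop :=
  forall i j : 'I_m, i != j -> [disjoint S i & S j] /\
    L * \sum_(x in S i) wrong_degree i j x (S j) <= #|S i| * #|S j|.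

(** A sparse pair (X, Y) is found first; [X] goes in front and the rest is built inside [Y]. Its
    members fill at least a fraction 1/C0 of [Y], so sparsity [L * C0] towards [Y] leaves sparsity
    [L] towards each of them. *)
Lemma forward_sequence (H : tournament) (m L : nat) : 1 < L ->
  exists2 C : nat, 0 < C & forall (T : tournament) (A : {set T}),
    ~~ contains T H -> C <= #|A| ->
    exists S : nat -> {set T},
      (forall i, i < m -> S i \subset A /\ #|A| <= C * #|S i|) /\
      (forall i j, i < j < m -> [disjoint S i & S j] /\
         L * \sum_(x in S i) \sum_(y in S j) (arc y x : nat) <= #|S i| * #|S j|).
Proof.
move=> L1; elim: m => [|m [C0 C00 IH]].
  by exists 1 => // T A _ _; exists (fun=> set0); split=> // i j; rewrite ltn0 andbF.
have [|C1 C10 pairH] := @sparse_pair H (L * C0).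
  by apply: leq_trans L1 _; rewrite leq_pmulr.
exists (C1 * C0) => [|T A TH CA]; first by rewrite muln_gt0 C10.
have [|X [Y [[XA YA] dXY AX AY le]]] := pairH T A TH.
  by apply: leq_trans CA; rewrite leq_pmulr.
have [|S [SY dS]] := IH T Y TH.
  by rewrite -(leq_pmul2l C10) (leq_trans CA).
exists (fun i => if i is i'.+1 then S i' else X); split=> [[|i] im|[|i] [|j] //= jm].
- by split=> //; apply: leq_trans AX _; rewrite leq_mul2r leq_pmulr ?orbT.
- have [SYi le'] := SY i im; split; first exact: subset_trans YA.
  by apply: leq_trans AY _; rewrite -mulnA leq_pmul2l.
- have [SYj leYS] := SY j jm; split; first exact: disjointWr SYj dXY.
  rewrite -(leq_pmul2l C00) mulnA [C0 * L]mulnC.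
  apply: (@leq_trans (#|X| * #|Y|)); last by rewrite mulnCA leq_mul2l leYS orbT.
  apply: leq_trans le; rewrite leq_mul2l; apply/orP; right.
  apply: leq_sum => x _; exact: leq_sum_subset.
- exact: dS.
Qed.

Lemma quasi_forward_exists (H : tournament) (m L : nat) : 1 < L ->
  exists2 C : nat, 0 < C & forall T : tournament,
    ~~ contains T H -> C <= #|T| ->
    exists2 S : 'I_m -> {set T}, quasi_forward L S & forall i, #|T| <= C * #|S i|.
Proof.
move=> /(forward_sequence H m)[C C0 P]; exists C => // T TH.
rewrite -cardsT => /(P T _ TH)[S [SC SL]].
exists (fun i => S i) => [i j ne|i]; last by case: (SC i).
rewrite /wrong_degree /wrong; case: (ltngtP i j) => [ij|ji|E].
- by apply: SL; rewrite ij /=.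
- have [|d le] := SL j i; first by rewrite ji /=.
  by rewrite disjoint_sym exchange_big /= [leqRHS]mulnC.
- by rewrite (ord_inj E) eqxx in ne.
Qed.

(* Markov's inequality for each of the m degrees. *)
Lemma low_degree_half (T : tournament) (m L : nat) (S : 'I_m -> {set T}) (i : 'I_m) :
  (forall j, 0 < #|S j|) -> quasi_forward (L * (m * 2)) S ->
  exists A : {set T}, [/\ A \subset S i, #|S i| <= 2 * #|A|
    & forall x j, x \in A -> i != j -> L * wrong_degree i j x (S j) <= #|S j|].
Proof.
move=> S0 qS; have m0 : 0 < m by apply: leq_ltn_trans (ltn_ord i).
pose Z j := [set x in S i | #|S j| < L * wrong_degree i j x (S j)].
have leZ j : i != j -> (m * 2) * #|Z j| <= #|S i|.
  move=> ij; have [_ le] := qS _ _ ij.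
  rewrite -(leq_pmul2r (S0 j)) -mulnA; apply: leq_trans le.
  rewrite (mulnC L) -[_ * L * _]mulnA leq_pmul2l ?muln_gt0 ?m0 //.
  rewrite -sum_nat_const.
  apply: (@leq_trans (\sum_(x in Z j) L * wrong_degree i j x (S j))).
    by apply: leq_sum => x; rewrite inE => /andP[_ /ltnW].
  rewrite big_distrr /=; apply: leq_sum_subset.
  by apply/subsetP=> x; rewrite inE => /andP[].
exists (S i :\: \bigcup_(j | i != j) Z j); split; first exact: subsetDl.
- have le : 2 * #|\bigcup_(j | i != j) Z j| <= #|S i|.
    rewrite -(leq_pmul2l m0) mulnA.
    apply: leq_trans (leq_mul (leqnn _) (leq_card_bigcup _ _ _)) _.
    rewrite big_distrr /=; apply: (@leq_trans (\sum_(j < m | i != j) #|S i|)).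
      by apply: leq_sum => j; apply: leZ.
    rewrite sum_nat_const leq_mul2r; apply/orP; right.
    by apply: leq_trans (max_card _) _; rewrite card_ord.
  have := subset_leq_card (subsetIr (S i) (\bigcup_(j | i != j) Z j)).
  have := subset_leq_card (subsetIl (S i) (\bigcup_(j | i != j) Z j)).
  by rewrite cardsD; lia.
- move=> x j; rewrite inE => /andP[xZ xS] ij; rewrite leqNgt.
  apply: contra xZ => lt; apply/bigcupP; exists j => //.
  by rewrite inE xS.
Qed.

(* The sets S_i are replaced one at a time by a good subset of their low-degree
   half; each replacement costs a factor 2m in the density of wrong pairs,
   however small the chosen subsets are. *)
Lemma quasi_forward_selection (T : tournament) (m L : nat) (S : 'I_m -> {set T})
    (good : 'I_m -> {set T} -> Prop) :
  (forall i (A : {set T}), A \subset S i -> #|S i| <= 2 * #|A| ->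
     exists B : {set T}, [/\ B \subset A, 0 < #|B| & good i B]) ->
  (forall i, 0 < #|S i|) -> quasi_forward (L * (m * 2) ^ m) S ->
  exists B : 'I_m -> {set T},
    (forall i, [/\ B i \subset S i, 0 < #|B i| & good i (B i)]) /\ quasi_forward L B.
Proof.
move=> goodP S0.
suff K n : n <= m -> forall L, quasi_forward (L * (m * 2) ^ n) S ->
    exists B : 'I_m -> {set T}, [/\ quasi_forward L B,
      forall i : 'I_m, B i \subset S i /\ 0 < #|B i|,
      forall i : 'I_m, i < n -> good i (B i)
    & forall i : 'I_m, n <= i -> B i = S i].
  move=> /(K m (leqnn m))[B [qB BS goodB _]]; exists B; split=> // i.
  by have [? ?] := BS i; split=> //; apply: goodB.
elim: n => [_ {}L|n IH lt {}L]; first by rewrite expn0 muln1; exists S.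
rewrite expnS mulnA => /(IH (ltnW lt))[B [qB BS goodB eqB]].
pose i0 := Ordinal lt.
have [A [sAB leA degA]] := low_degree_half i0 (fun j => (BS j).2) qB.
have [||D [sDA D0 goodD]] := goodP i0 A.
- by rewrite -(eqB i0).
- by rewrite -(eqB i0).
have degD j : i0 != j ->
    L * \sum_(x in D) wrong_degree i0 j x (B j) <= #|D| * #|B j|.
  move=> ne; rewrite big_distrr /= -sum_nat_const; apply: leq_sum => x xD.
  by apply: degA ne; apply: (subsetP sDA).
exists (fun i => if i == i0 then D else B i); split=> [i j ne||i|i].
- case: (i =P i0) => [E|/eqP ni]; case: (j =P i0) => [E'|/eqP nj].
  + by rewrite E E' eqxx in ne.
  + rewrite {i}E in ne *; have [dB _] := qB _ _ ne; split; last exact: degD.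
    exact: disjointWl (subset_trans sDA sAB) dB.
  + rewrite {j}E' in ne *; have [dB _] := qB _ _ ne; split.
      exact: disjointWr (subset_trans sDA sAB) dB.
    rewrite /wrong_degree exchange_big /= [leqRHS]mulnC.
    rewrite eq_sym in ne; apply: leq_trans (degD i ne).
    rewrite leq_mul2l; apply/orP; right; apply: leq_sum => x _.
    by apply: leq_sum => y _; rewrite wrong_sym // eq_sym.
  + have [dB le] := qB _ _ ne; split=> //; apply: leq_trans le.
    by rewrite leq_mul2r leq_pmulr ?orbT // muln_gt0 (leq_ltn_trans _ lt).
- move=> i; case: eqP => // ->; split=> //.
  by rewrite -(eqB i0) // (subset_trans sDA).
- rewrite ltnS leq_eqVlt; have [-> //|ni /orP[/eqP E|]] := eqVneq i i0.
  + by case/eqP: ni; apply: ord_inj.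
  + exact: goodB.
- move=> lt'; case: eqP => [E|_]; first by rewrite E ltnn in lt'.
  by apply: eqB; apply: ltnW.
Qed.

(** The passage from average to individual degrees. All sets are halved at once, with degrees
    measured against the old [S j]; the extra factor 2 converts this to the halved sets. *)
Lemma low_degree_halves (T : tournament) (m L : nat) (S : 'I_m -> {set T}) :
  (forall j, 0 < #|S j|) -> quasi_forward (L * 2 * (m * 2)) S ->
  exists B : 'I_m -> {set T},
    (forall i, B i \subset S i /\ #|S i| <= 2 * #|B i|) /\
    (forall i j x, i != j -> x \in B i -> L * wrong_degree i j x (B j) <= #|B j|).
Proof.
move=> S0 qS; have /choice[B BP] := fun i => low_degree_half i S0 qS.
exists B; split=> [i|i j x ne xB]; first by have [] := BP i.
have [_ _ deg] := BP i; have [sB leB _] := BP j.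
have := leq_trans (deg _ _ xB ne) leB.
rewrite -mulnA (mulnC L) -mulnA leq_pmul2l //; apply: leq_trans.
by rewrite mulnC leq_mul2r wrong_degreeS ?orbT.
Qed.

(** * Critical tournaments *)

(** One parameter bounds [tr T] from below, fixes which sets count as linear, and sets the precision
    K / (K+1) of the acyclic subsets, so the condition strengthens as [K] grows. *)
Definition critical (K : nat) (T : tournament) : Prop :=
  K <= tr T /\ forall A : {set T}, #|T| <= K * #|A| ->
    exists B : {set T}, [/\ B \subset A, acyclic B & K * tr T <= K.+1 * #|B|].

(** K / (K+1) increases with [K]; denominators are cleared. *)
Lemma leq_ratio (K K' t b : nat) :
  K <= K' -> K' * t <= K'.+1 * b -> K * t <= K.+1 * b.
Proof.
have [-> //|K0 KK' le] := posnP K; have K'0 : 0 < K' by apply: leq_trans KK'.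
rewrite -(leq_pmul2l K'0) mulnCA.
apply: leq_trans (leq_mul (leqnn K) le) _.
by rewrite !mulSn !mulnDr (mulnCA K K') leq_add2r leq_mul2r KK' orbT.
Qed.

Lemma critical_leq (K K' : nat) (T : tournament) :
  K <= K' -> critical K' T -> critical K T.
Proof.
move=> KK' [trT crT]; split=> [|A leA]; first exact: leq_trans trT.
have [|B [BA acB leB]] := crT A; last by exists B; split=> //; apply: leq_ratio leB.
by apply: leq_trans leA _; rewrite leq_mul2r KK' orbT.
Qed.

Lemma critical_acyclic (K : nat) (T : tournament) (A : {set T}) :
  0 < K -> critical K T -> #|T| <= K * #|A| ->
  exists B : {set T}, [/\ B \subset A, acyclic B & tr T <= 2 * #|B|].
Proof.
move=> K0 [_ crT] /crT[B [BA acB leB]]; exists B; split=> //.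
by rewrite -[leqLHS]mul1n; apply: leq_ratio leB.
Qed.

Lemma leq_tr_card (T : tournament) : tr T <= #|T|.
Proof. by have [A _ <-] := tr_witness T; apply: max_card. Qed.

(** A linear subset of [W] is linear in [T] up to the factor [D], and passing to [W] does not
    increase [tr], so the acyclic subsets provided by [T] serve. The bound [2 * K <= K'] ensures
    that an acyclic subset of [W] with at least half of [tr T] vertices has size at least [K]. *)
Lemma critical_induced (D K K' : nat) (T : tournament) (W : {set T}) :
  0 < K -> D * K <= K' -> 2 * K <= K' -> #|T| <= D * #|W| ->
  critical K' T -> critical K (induced W).
Proof.
move=> K0 DK KK leW crT; have K'0 : 0 < K' by lia.
have [trT crT'] := crT.
have sub (A : {set induced W}) : #|induced W| <= K * #|A| ->
    exists B : {set induced W}, [/\ B \subset A, acyclic B & K' * tr T <= K'.+1 * #|B|].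
  rewrite card_induced => leA; have [|B [BA acB leB]] := crT' (val @: A).
    rewrite card_imset; last exact: val_inj.
    apply: leq_trans leW _; apply: leq_trans (leq_mul (leqnn D) leA) _.
    by rewrite mulnA leq_mul2r DK orbT.
  have BW : B \subset W.
    by apply: subset_trans BA _; apply/subsetP=> _ /imsetP[x _ ->]; apply: valP.
  exists (trace W B); rewrite card_trace //; split=> //; last exact: acyclic_trace.
  apply/subsetP=> x; rewrite inE => /(subsetP BA)/imsetP[y yA E].
  by rewrite (val_inj E).
split.
  have [|B [_ acB leB]] := sub setT.
    by rewrite cardsT leq_pmull.
  apply: leq_trans (leq_tr acB).
  have : tr T <= 2 * #|B| by rewrite -[leqLHS]mul1n; apply: leq_ratio leB.
  by lia.
move=> A /sub[B [BA acB leB]]; exists B; split=> //.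
apply: (@leq_trans (K * tr T)).
  rewrite leq_mul2l; apply/orP; right.
  have [A' acA' <-] := tr_witness (induced W).
  rewrite -(card_imset _ val_inj); exact: leq_tr (acyclic_val acA').
by apply: leq_ratio leB => //; lia.
Qed.

(** The arcs order an acyclic set linearly; the parts are consecutive windows of the sorted list.
    The factor 2 covers the dropped remainder. *)
Lemma acyclic_chunks (T : tournament) (A : {set T}) (q : nat) :
  acyclic A -> 0 < q <= #|A| ->
  exists s : seq {set T}, [/\ size s = q,
    {in s, forall B : {set T}, B \subset A /\ #|A| <= 2 * q * #|B|}
    & forall a b, a < b < size s -> complete_to (nth set0 s a) (nth set0 s b)].
Proof.
move=> acA /andP[q0 qA].
pose r := fun x y : T => (x == y) || arc x y; pose s := sort r (enum A).
have rtot : total r.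
  by move=> x y; rewrite /r; case: eqVneq => //= ne; rewrite (arc_tot ne) orbN.
have us : uniq s by rewrite sort_uniq enum_uniq.
have memS x : (x \in s) = (x \in A) by rewrite mem_sort mem_enum.
have sorted_s : sorted r s by apply: sort_sorted.
have rtr : {in s & &, transitive r}.
  move=> y x z; rewrite !memS => yA xA zA /orP[/eqP-> //|xy] /orP[/eqP<-|yz].
    by rewrite /r xy orbT.
  by rewrite /r (proj1 (acyclicP A) acA _ _ _ yA xA zA xy yz) orbT.
have ss : size s = #|A| by rewrite size_sort -cardE.
pose N := #|A| %/ q.
have N0 : 0 < N by rewrite divn_gt0.
have leN : #|A| <= 2 * q * N.
  by have := divn_eq #|A| q; have := ltn_pmod #|A| q0; rewrite -/N; nia.
exists (mkseq (chunk N s) q); rewrite size_mkseq; split=> //.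
  move=> B /mapP[i]; rewrite mem_iota add0n => /andP[_ iq] ->; split.
    by apply/subsetP=> x; rewrite inE memS => /andP[].
  apply: leq_trans leN _; rewrite leq_mul2l; apply/orP; right.
  apply: card_chunk => //; rewrite ss; apply: leq_trans (leq_trunc_div _ q).
  by rewrite mulnC leq_mul2l iq orbT.
move=> a b /andP[ab bq] x y; rewrite !nth_mkseq ?(ltn_trans ab) // => xa yb.
have lt := chunk_index xa yb ab.
have xs : x \in s by move: xa; rewrite inE => /andP[].
have ys : y \in s by move: yb; rewrite inE => /andP[].
have /orP[/eqP E|//] := sorted_ltn_index_in rtr sorted_s _ _ xs ys lt.
by rewrite E ltnn in lt.
Qed.

(** * Smooth sequences and their construction *)

Section Smooth.
Variables (m : nat) (v : m.-tuple bool) (eta : (zeta v m).-tuple nat).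

(** A discrete variant of [m_sequence]: density between blocks is replaced by a bound on the wrong
    degree of each vertex into each part, which survives, up to a factor 2, the halving of all
    parts. *)
Record smooth (T : tournament) (L C : nat) (chi : blocks m T) : Prop := Smooth {
  smooth_size : forall i, size (tnth chi i) = block_size eta i;
  smooth_disjoint : forall i j : 'I_m, i != j ->
    [disjoint block chi i & block chi j];
  smooth_acyclic : forall i, tnth v i -> acyclic (block chi i);
  smooth_order : forall i a b, a < b < size (tnth chi i) ->
    complete_to (nth set0 (tnth chi i) a) (nth set0 (tnth chi i) b);
  smooth_part : forall i (B : {set T}), tnth v i -> B \in tnth chi i ->
    tr T <= C * #|B|;
  smooth_linear : forall i (B : {set T}), ~~ tnth v i -> B \in tnth chi i ->
    #|T| <= C * #|B|;
  smooth_degree : forall (i j : 'I_m) x (B : {set T}), i != j ->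
    x \in block chi i -> B \in tnth chi j ->
    L * wrong_degree i j x B <= #|B| }.

Lemma zeta_lt (i : 'I_m) : tnth v i -> zeta v i < zeta v m.
Proof.
move=> vi; rewrite /zeta [X in _ < count _ X]take_oversize ?size_tuple //.
rewrite -[X in _ < count _ X](cat_take_drop i v) count_cat -addn1 leq_add2l.
rewrite (drop_nth (tnth v i)) ?size_tuple //= -tnth_nth vi.
by [].
Qed.

Lemma block_size_bounds (i : 'I_m) : all (fun a => 0 < a) eta ->
  0 < block_size eta i <= (\sum_(a <- eta) a).+1.
Proof.
move=> eta0; rewrite /block_size; case: ifP => // /zeta_lt lt.
have mem : nth 0 eta (zeta v i) \in (eta : seq nat) by rewrite mem_nth ?size_tuple.
by rewrite (allP eta0 _ mem) /= (big_rem _ mem) /= leqW // leq_addr.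
Qed.

(** Three refinements: a selection making the blocks with v(i) = 1 acyclic, a halving that bounds
    individual degrees, and a cut into parts. They account for the factors [(m * 2) ^ m],
    [2 * (m * 2)] and [2 * Q] of the required sparsity. *)
Lemma smooth_of_quasi_forward (L : nat) (T : tournament) (S : 'I_m -> {set T})
    (Q := (\sum_(a <- eta) a).+1) :
  all (fun a => 0 < a) eta -> critical (4 * Q + 2 * m.+1) T ->
  (forall i, #|T| <= m.+1 * #|S i|) ->
  quasi_forward (2 * Q * L * 2 * (m * 2) * (m * 2) ^ m) S ->
  exists chi : blocks m T, smooth L (8 * Q + 4 * m.+1) chi.
Proof.
(* [2 * m.+1] makes half of an [S i] linear for criticality; [4 * Q] leaves acyclic sets with at
   least [Q] vertices to cut. *)
move=> eta0 crT leS qS; pose K := 4 * Q + 2 * m.+1.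
have K0 : 0 < K by rewrite /K; lia.
have Q0 : 0 < Q by [].
have [trK _] := crT; rewrite -/K in crT trK.
have T0 : 0 < #|T| by apply: leq_trans (leq_tr_card T); apply: leq_trans trK.
have S0 i : 0 < #|S i| by have := leS i; case: #|S i| => //; lia.
pose good i (B : {set T}) :=
  if tnth v i then acyclic B /\ tr T <= 2 * #|B| else #|S i| <= 2 * #|B|.
have [|B [BP qB]] := quasi_forward_selection (good := good) _ S0 qS.
  move=> i A AS leA; have A0 : 0 < #|A| by have := S0 i; lia.
  have [vi|/negbTE vi] := boolP (tnth v i); last by exists A; rewrite /good vi.
  have [|B [BA acB leB]] := critical_acyclic K0 crT (A := A).
    apply: leq_trans (leS i) _; rewrite /K.
    apply: leq_trans (leq_mul (leqnn _) leA) _; rewrite mulnA leq_mul2r.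
    by apply/orP; right; lia.
  by exists B; rewrite /good vi; split=> //; lia.
have B0 i : 0 < #|B i| by case: (BP i).
have [B' [B'P degB']] := low_degree_halves B0 qB.
have /choice[f fP] : forall i, exists s : seq {set T},
    [/\ size s = block_size eta i,
        {in s, forall P : {set T}, P \subset B' i /\ #|B' i| <= 2 * Q * #|P|},
        (forall a b, a < b < size s -> complete_to (nth set0 s a) (nth set0 s b)) &
        tnth v i \/ s = [:: B' i]].
  move=> i; have [BS B0i goodB] := BP i; have [B'B leB'] := B'P i.
  have /andP[b0 bQ] := block_size_bounds i eta0.
  rewrite /good in goodB; case: ifP goodB => vi.
    case=> acB leB.
    have [||s [ss sP so]] := @acyclic_chunks _ (B' i) (block_size eta i).
    - exact: acyclicS acB.
    - by rewrite b0 /=; move: trK; rewrite /K -/Q in bQ *; lia.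
    exists s; split=> //; last by left.
    move=> P /sP[? le]; split=> //; apply: leq_trans le _.
    by rewrite leq_mul2r leq_mul2l bQ !orbT.
  move=> leB; exists [:: B' i]; split=> //=.
  - by rewrite /block_size vi.
  - move=> P; rewrite inE => /eqP->; split=> //.
    by rewrite leq_pmull // muln_gt0.
  - by move=> a b /andP[]; lia.
  - by right.
have blockE i : block [tuple f i | i < m] i \subset B' i.
  rewrite /block tnth_mktuple bigcup_seq; apply/bigcupsP=> P Pf.
  by have [_ /(_ P Pf)[]] := fP i.
exists [tuple f i | i < m]; split=> [i|i j ne|i vi|i a b|i P vi|i P vi|i j x P ne].
- by rewrite tnth_mktuple; have [] := fP i.
- apply: disjointWl (blockE i) _; apply: disjointWr (blockE j) _.
  apply: disjointWl (proj1 (B'P i)) _; apply: disjointWr (proj1 (B'P j)) _.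
  by have [] := qB _ _ ne.
- apply: acyclicS (blockE i) _; apply: acyclicS (proj1 (B'P i)) _.
  by have [_ _] := BP i; rewrite /good vi => -[].
- by rewrite tnth_mktuple; have [_ _ + _] := fP i; apply.
(* Losses of 2 from criticality, 2 from halving and [2 * Q] from cutting multiply to [8 * Q]. *)
- rewrite tnth_mktuple => Pf; have [_ /(_ P Pf)[_ le] _ _] := fP i.
  have [_ _] := BP i; rewrite /good vi => -[_ leB].
  have [_ leB'] := B'P i; apply: leq_trans leB _.
  apply: leq_trans (leq_mul (leqnn 2) leB') _.
  apply: leq_trans (leq_mul (leqnn 2) (leq_mul (leqnn 2) le)) _.
  by rewrite !mulnA leq_mul2r leq_addr orbT.
- rewrite tnth_mktuple => Pf; have [_ _ _ [|fE]] := fP i; first by rewrite (negbTE vi).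
  move: Pf; rewrite fE inE => /eqP->.
  have [_ _] := BP i; rewrite /good (negbTE vi) => leB.
  have [_ leB'] := B'P i; apply: leq_trans (leS i) _.
  apply: leq_trans (leq_mul (leqnn _) leB) _.
  apply: leq_trans (leq_mul (leqnn _) (leq_mul (leqnn 2) leB')) _.
  by rewrite !mulnA leq_mul2r; apply/orP; right; lia.
- move=> /(subsetP (blockE i)) xB; rewrite tnth_mktuple => Pf.
  have [_ /(_ P Pf)[PB le] _ _] := fP j.
  have := leq_trans (degB' _ _ _ ne xB) le.
  rewrite -mulnA leq_pmul2l ?muln_gt0 //; apply: leq_trans.
  by rewrite leq_mul2l wrong_degreeS ?orbT.
Qed.

End Smooth.

Lemma subset_of_card (U : finType) (A : {set U}) (n : nat) : n <= #|A| ->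
  exists2 B : {set U}, B \subset A & #|B| = n.
Proof.
move=> le; exists [set x in take n (enum A)].
  by apply/subsetP=> x; rewrite inE => /mem_take; rewrite mem_enum.
rewrite cardsE (card_uniqP _) ?take_uniq ?enum_uniq // size_takel //.
by rewrite -cardE.
Qed.

Lemma quasi_trace (T : tournament) (W : {set T}) (m L : nat) (S : 'I_m -> {set T}) :
  (forall i, S i \subset W) -> quasi_forward L S ->
  quasi_forward L (fun i => trace W (S i)).
Proof.
move=> SW qS i j ne; have [dS le] := qS i j ne; split.
  apply/pred0P=> x /=; rewrite !inE.
  by have /setP/(_ (val x)) := disjoint_setI0 dS; rewrite !inE.
rewrite !card_trace //; apply: leq_trans le; rewrite leq_mul2l; apply/orP; right.
rewrite -(sum_trace _ (SW i)); apply: leq_sum => x _.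
by rewrite /wrong_degree -(sum_trace _ (SW j)).
Qed.

Lemma quasi_leq (T : tournament) (m L L' : nat) (S : 'I_m -> {set T}) :
  L <= L' -> quasi_forward L' S -> quasi_forward L S.
Proof.
move=> LL' qS i j ne; have [dS le] := qS i j ne; split=> //.
by apply: leq_trans le; rewrite leq_mul2r LL' orbT.
Qed.

(* C is chosen before L: the blocks have size at least |W| / m.+1 in the induced
   tournament, whatever the bound L on the backward degrees. *)
Lemma smooth_in_critical (H : tournament) (m : nat) (v : m.-tuple bool)
    (eta : (zeta v m).-tuple nat) : all (fun a => 0 < a) eta ->
  exists2 C, 0 < C & forall L K, exists K', forall T : tournament,
    critical K' T -> ~~ contains T H ->
    exists (W : {set T}) (chi : blocks m (induced W)),
      smooth eta L C chi /\ critical K (induced W).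
Proof.
move=> eta0; set Q := (\sum_(a <- eta) a).+1.
exists (8 * Q + 4 * m.+1) => [|L K]; first by rewrite /Q; lia.
set L1 := 2 * Q * L * 2 * (m * 2) * (m * 2) ^ m.
(* Working with [m.+1] sets keeps [W] nonempty even when m = 0; [.+2] makes the sparsity exceed
   1. *)
have [C1 C10 qH] := @quasi_forward_exists H m.+1 (L1 * (m.+1 * 2) ^ m.+1).+2 isT.
set K1 := K.+1 + (4 * Q + 2 * m.+1).
(* This suits [critical_induced] with D = 4 C1, since |T| <= 4 C1 n <= 4 C1 |W| below. *)
exists (4 * C1 * K1 + 2 * K1) => T crT TH.
have trK : 4 * C1 * K1 + 2 * K1 <= #|T|.
  by have [trT _] := crT; apply: leq_trans trT (leq_tr_card T).
have K10 : 0 < K1 by rewrite /K1; lia.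
have CK : 4 * C1 <= 4 * C1 * K1 by rewrite leq_pmulr.
have [|S qS leS] := qH T TH; first by lia.
(* A common size that fits into every half of an [S i]; equal sizes make each set a fraction 1/(m+1)
   of the union. *)
pose n := #|T| %/ (2 * C1).
have n0 : 0 < n by rewrite divn_gt0; lia.
have S0 i : 0 < #|S i| by have := leS i; case: #|S i| => //; lia.
have leT : #|T| <= 4 * C1 * n.
  have C2 : 0 < 2 * C1 by lia.
  by have := divn_eq #|T| (2 * C1); have := ltn_pmod #|T| C2; rewrite -/n; nia.
have [||B [BP qB]] :=
  quasi_forward_selection (good := fun i B => #|B| = n) (L := L1) (S := S) _ S0.
- move=> i A AS leA; have [|B BA cB] := @subset_of_card _ A n.
    rewrite -(@leq_pmul2r (2 * C1)) ?muln_gt0 ?C10 //.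
    apply: leq_trans (leq_trunc_div _ _) _; apply: leq_trans (leS i) _.
    apply: leq_trans (leq_mul (leqnn _) leA) _.
    by rewrite mulnCA [leqRHS]mulnC mulnA.
  by exists B; rewrite cB.
- by apply: quasi_leq qS; rewrite leqW.
pose W := \bigcup_i B i.
have BW i : B i \subset W by apply: bigcup_sup.
have cB i : #|B i| = n by case: (BP i).
have crW : critical K1 (induced W).
  apply: critical_induced crT => //.
  - exact: leq_addr.
  - exact: leq_addl.
  apply: leq_trans leT _; rewrite leq_mul2l -(cB ord0) subset_leq_card ?orbT //.
pose wi (i : 'I_m) := widen_ord (leqnSn m) i.
have [||i||chi sm] := @smooth_of_quasi_forward m v eta L (induced W)
  (fun i => trace W (B (wi i))).
- exact: eta0.
- by apply: critical_leq crW; apply: leq_addl.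
- rewrite card_trace // cB card_induced.
  apply: leq_trans (leq_card_bigcup _ _ _) _.
  by rewrite (eq_bigr (fun=> n)) // sum_nat_const card_ord.
- apply: quasi_trace => // i j ne.
  by have := qB (wi i) (wi j) ne.
exists W, chi; split=> //; apply: critical_leq crW.
by rewrite /K1; lia.
Qed.

(** * From critical tournaments to the strong EH-property *)

(** Bernoulli's inequality for (1 + 1/K)^n, with denominators cleared. *)
Lemma bernoulli (K n : nat) : K ^ n * (K + n) <= K * K.+1 ^ n.
Proof.
elim: n => [|n IH]; first by rewrite !expn0 mul1n muln1 addn0.
rewrite [K.+1 ^ _]expnSr mulnA.
apply: leq_trans (leq_mul IH (leqnn _)).
by rewrite expnSr -!mulnA leq_mul2l; apply/orP; right; nia.
Qed.

(* In a minimal counterexample T, a set A with |T| <= K |A| has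
   tr T ^ K^2 < |T| <= K * tr A ^ K^2, and (1 + 1/K) ^ K^2 > K. *)
Lemma card_leq_tr (H : tournament) (K : nat) : 0 < K ->
  (forall T, critical K T -> contains T H) ->
  forall T, ~~ contains T H -> #|T| <= tr T ^ (K ^ 2).
Proof.
move=> K0 crH T; have [n] := ubnP #|T|; elim: n T => // n IH T leT TH.
set N := K ^ 2; have N0 : 0 < N by rewrite expn_gt0 K0.
have KN : K <= N by rewrite /N expnS expn1 leq_pmulr.
rewrite leqNgt; apply/negP=> lt; apply/(negP TH)/crH; split.
  (* If tr T < K, then |T| < 2^K by [acyclic_log]; but two vertices already give tr T >= 2, hence
     |T| > 2^(K^2) >= 2^K. *)
  rewrite leqNgt; apply/negP=> trK.
  have T2K : #|T| < 2 ^ K.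
    rewrite ltnNge; apply/negP; rewrite -cardsT => /acyclic_log[B [_ acB leB]].
    by have := leq_tr acB; lia.
  have [T1|T1] := leqP #|T| 1.
    have /card_gt0P[x _] : 0 < #|T| by lia.
    have := leq_tr (acyclic1 x); rewrite cards1 => tr1.
    by have : 0 < tr T ^ N; [rewrite expn_gt0 tr1|lia].
  have [|B [_ acB leB]] := @acyclic_log T 1 setT; first by rewrite cardsT.
  have : 2 ^ N <= tr T ^ N by rewrite leq_exp2r //; have := leq_tr acB; lia.
  have : 2 ^ K <= 2 ^ N by rewrite leq_exp2l.
  by lia.
(* The induction needs a proper subset; for the whole vertex set a maximum acyclic set serves. *)
move=> A leA; have [->|neA] := eqVneq A setT.
  have [B acB cB] := tr_witness T; exists B; rewrite cB; split=> //.
  by rewrite leq_mul2r leqnSn orbT.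
have ltA : #|A| < #|T|.
  rewrite -cardsT; apply: proper_card; rewrite properE subsetT /=.
  by apply: contra neA => h; rewrite eqEsubset subsetT.
have := IH (induced A); rewrite card_induced => /(_ _ _).
have [B0 acB0 <-] := tr_witness (induced A).
move=> IHA; have leB : #|A| <= #|B0| ^ N.
  apply: IHA; first by lia.
  by apply: contra TH; apply: contains_trans (contains_induced A).
exists (val @: B0); rewrite (card_imset _ val_inj); split.
- by apply/subsetP=> _ /imsetP[x _ ->]; apply: valP.
- exact: acyclic_val.
rewrite leqNgt; apply/negP=> lt'.
have B0N : 0 < #|B0| ^ N.
  by case: (posnP (#|B0| ^ N)) => // E; move: leB leA; rewrite E leqn0 => /eqP->; lia.
have le1 : K.+1 ^ N * #|B0| ^ N < K * K ^ N * #|B0| ^ N.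
  apply: (@leq_ltn_trans (K ^ N * tr T ^ N)); first by rewrite -!expnMn leq_exp2r // ltnW.
  rewrite mulnAC [ltnRHS]mulnC ltn_pmul2l ?expn_gt0 ?K0 //.
  apply: leq_trans lt _; apply: leq_trans leA _.
  by rewrite leq_mul2l leB orbT.
move: le1; rewrite ltn_pmul2r // => le1.
(* As K + K^2 = K (K+1), Bernoulli gives K^N (K+1) <= (K+1)^N, against (K+1)^N < K^(N+1). *)
have := bernoulli K N; have KE : K + N = K * K.+1.
  by rewrite /N expnS expn1 mulnSr addnC.
rewrite KE mulnCA leq_pmul2l // => le2.
by have := leq_ltn_trans le2 le1; rewrite mulnC ltn_mul2r => /andP[_]; lia.
Qed.

(** * Smooth sequences as m-sequences without strong pairs *)

Lemma sum_bigcup_seq (U : finType) (s : seq {set U}) (F : U -> nat) :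
  (forall a b, a < b < size s -> [disjoint nth set0 s a & nth set0 s b]) ->
  \sum_(y in \bigcup_(B <- s) B) F y = \sum_(B <- s) \sum_(y in B) F y.
Proof.
elim: s => [|A s IH] ds; first by rewrite !big_nil big_set0.
rewrite !big_cons -IH => [|a b ab]; last by apply: (ds a.+1 b.+1).
rewrite -bigU /=; first by apply: eq_bigl => y; rewrite !inE.
rewrite bigcup_seq; apply: bigcup_disjoint => B Bs.
by have := ds 0 (index B s).+1; rewrite /= ltnS index_mem nth_index //; apply.
Qed.

Section SmoothProperties.
Variables (m : nat) (v : m.-tuple bool) (eta : (zeta v m).-tuple nat).
Variables (T : tournament) (L C : nat) (chi : blocks m T).
Hypothesis smc : smooth eta L C chi.

Lemma smooth_sum_block (F : T -> nat) (i : 'I_m) :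
  \sum_(y in block chi i) F y = \sum_(B <- tnth chi i) \sum_(y in B) F y.
Proof.
apply: sum_bigcup_seq => a b ab.
exact/complete_to_disjoint/(smooth_order smc).
Qed.

Lemma smooth_block_degree (i j : 'I_m) (x : T) :
  i != j -> x \in block chi i ->
  L * wrong_degree i j x (block chi j) <= #|block chi j|.
Proof.
move=> ne xi; rewrite -sum1_card /wrong_degree !smooth_sum_block big_distrr /=.
rewrite big_seq [leqRHS]big_seq; apply: leq_sum => B Bj.
by rewrite sum1_card; apply: (smooth_degree smc).
Qed.

Lemma smooth_piece (i : 'I_m) (B : {set T}) : B \in tnth chi i -> B \subset block chi i.
Proof. by move=> Bi; rewrite /block bigcup_seq; apply: (bigcup_sup B). Qed.

Lemma smooth_block_gt0 (i : 'I_m) :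
  all (fun a => 0 < a) eta -> 0 < #|T| -> 0 < tr T -> 0 < #|block chi i|.
Proof.
move=> eta0 T0 tr0; have /andP[b0 _] := block_size_bounds i eta0.
have Bi : nth set0 (tnth chi i) 0 \in tnth chi i.
  by rewrite mem_nth // (smooth_size smc).
have := subset_leq_card (smooth_piece Bi); apply: leq_trans.
have pos t a : 0 < t -> t <= C * a -> 0 < a by case: a => //; lia.
have [vi|vi] := boolP (tnth v i).
  exact: pos (smooth_part smc vi Bi).
exact: pos (smooth_linear smc vi Bi).
Qed.

End SmoothProperties.

Lemma card_arcs (T : tournament) (A B : {set T}) :
  #|[set p : T * T | [&& p.1 \in A, p.2 \in B & arc p.1 p.2]]| =
  \sum_(x in A) \sum_(y in B) (arc x y : nat).
Proof.
rewrite pair_big /= -sum1_card big_mkcond [RHS]big_mkcond; apply: eq_bigr => p _.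
by rewrite inE; case: (p.1 \in A) => //=; case: (p.2 \in B) => //=; case: arc.
Qed.

Lemma arcs_wrong (T : tournament) (A B : {set T}) (i j : nat) : i < j ->
  [disjoint A & B] ->
  \sum_(x in A) \sum_(y in B) (arc x y : nat) +
    \sum_(x in A) wrong_degree i j x B = #|A| * #|B|.
Proof.
move=> ij dAB; rewrite -big_split -sum_nat_const; apply: eq_bigr => x xA.
rewrite -big_split -sum1_card; apply: eq_bigr => y yB.
have ne : x != y.
  apply: contraTneq yB => <-.
  by have /setP/(_ x) := disjoint_setI0 dAB; rewrite !inE xA /= => ->.
by rewrite /wrong ij (arc_tot ne); case: arc.
Qed.

Local Open Scope ring_scope.

Section Reals.
Variable R : realType.

Lemma density1_complete (T : tournament) (A B : {set T}) :
  density R A B = 1 -> complete_to A B.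
Proof.
rewrite /density; set N := [set p | _] => E.
(* An empty set would make the denominator, hence the density, 0. *)
have ab0 : (#|A| * #|B|)%:R != 0 :> R.
  by apply: contra_eq_neq E => ->; rewrite invr0 mulr0 eq_sym oner_neq0.
have cN : #|N| = (#|A| * #|B|)%N.
  by apply/eqP; rewrite -(eqr_nat R) -[X in X == _](divfK ab0) E mul1r.
have sN : N \subset setX A B.
  by apply/subsetP=> p; rewrite !inE => /and3P[-> ->].
have /eqP EN : N == setX A B by rewrite eqEcard sN cardsX cN leqnn.
move=> x y xA yB; have : (x, y) \in setX A B by rewrite inE /= xA yB.
by rewrite -EN inE => /and3P[].
Qed.

Lemma leq_of_ler (c : R) (K t a : nat) :
  1 <= c * K%:R -> c * t%:R <= a%:R -> (t <= K * a)%N.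
Proof.
move=> cK ct; rewrite -(ler_nat R) natrM.
apply: (@le_trans _ _ (c * K%:R * t%:R)); first by rewrite ler_peMl.
by rewrite mulrAC [leRHS]mulrC ler_wpM2r.
Qed.

Lemma ler_of_leq (c : R) (C t a : nat) :
  0 < c -> c * C%:R <= 1 -> (t <= C * a)%N -> c * t%:R <= a%:R.
Proof.
move=> c0 cC; rewrite -(ler_nat R) natrM -(ler_pM2l c0) => /le_trans; apply.
by rewrite mulrA ler_piMl.
Qed.

(** [A] contains an acyclic set of size at least K/(K+1) tr T and [B] one of size at least tr T / K.
    Completeness makes their union acyclic, yet K/(K+1) + 1/K > 1. *)
Lemma no_strong_pair (m : nat) (T : tournament) (c : R) (K : nat)
    (chi : blocks m T) (A B : {set T}) :
  (1 < K)%N -> 1 <= c * K%:R -> critical K T -> ~ strong_pair c chi A B.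
Proof.
move=> K1 cK crT; have [trK crT'] := crT.
have no (A' B' : {set T}) : acyclic A' -> acyclic B' ->
    (K * tr T <= K.+1 * #|A'|)%N -> (tr T <= K * #|B'|)%N ->
    complete_to A' B' \/ complete_to B' A' -> False.
  move=> acA acB leA leB cAB.
  have le : (#|A'| + #|B'| <= tr T)%N.
    case: cAB => cAB.
      rewrite -cardsUI (disjoint_setI0 (complete_to_disjoint cAB)) cards0 addn0.
      exact/leq_tr/acyclicU.
    rewrite addnC -cardsUI (disjoint_setI0 (complete_to_disjoint cAB)) cards0 addn0.
    exact/leq_tr/acyclicU.
  by nia.
case=> _ _ /(leq_of_ler cK) leA leB cAB.
have [A' [A'A acA' leA']] := crT' A leA.
have [B' [B'B acB' leB']] : exists B' : {set T},
    [/\ B' \subset B, acyclic B' & (tr T <= K * #|B'|)%N].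
  case: leB => [/(leq_of_ler cK) leB|[acB /(leq_of_ler cK) leB]]; last by exists B.
  have [B' [B'B acB' leB']] := critical_acyclic (ltnW K1) crT leB.
  by exists B'; split=> //; apply: leq_trans leB' _; rewrite leq_mul2r K1 orbT.
apply: (no A' B') => //.
case: cAB => /density1_complete cAB; [left|right] => x y xA yB; apply: cAB.
- exact: subsetP xA.
- exact: subsetP yB.
- exact: subsetP xA.
- exact: subsetP yB.
Qed.

Lemma smooth_m_sequence (m : nat) (v : m.-tuple bool)
    (eta : (zeta v m).-tuple nat) (T : tournament) (L C : nat)
    (chi : blocks m T) (c lambda : R) :
  all (fun a => 0 < a)%N eta -> (0 < #|T|)%N -> (0 < tr T)%N ->
  0 < c -> c * C%:R <= 1 -> 0 <= lambda < 1 -> 1 <= lambda * L%:R ->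
  smooth eta L C chi -> m_sequence eta c lambda chi.
Proof.
move=> eta0 T0 tr0 c0 cC l01 lL sm.
split=> // [i|i j|i|i vi a la|i vi a b ab|i vi|i j ij].
- exact: smooth_size sm i.
- exact: (smooth_disjoint sm).
- exact: (smooth_acyclic sm).
- by apply: (ler_of_leq c0 cC); apply: (smooth_part sm vi); rewrite mem_nth.
- have cab := smooth_order sm ab; split=> //; exact: complete_to_disjoint.
- apply: (ler_of_leq c0 cC).
  have Bi : nth set0 (tnth chi i) 0 \in tnth chi i.
    by rewrite mem_nth // (smooth_size sm) /block_size (negbTE vi).
  apply: leq_trans (smooth_linear sm vi Bi) _.
  by rewrite leq_mul2l subset_leq_card ?orbT // smooth_piece.
have ne : i != j by rewrite -val_eqE /= ltn_eqF.
set A := block chi i; set B := block chi j.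
have A0 : (0 < #|A|)%N by apply: smooth_block_gt0 sm i eta0 T0 tr0.
have B0 : (0 < #|B|)%N by apply: smooth_block_gt0 sm j eta0 T0 tr0.
have dAB : [disjoint A & B] by apply: (smooth_disjoint sm).
have sumE := arcs_wrong ij dAB.
have leW : (L * \sum_(x in A) wrong_degree i j x B <= #|A| * #|B|)%N.
  rewrite big_distrr /= -sum_nat_const; apply: leq_sum => x xA.
  exact: smooth_block_degree sm _ _ _ ne xA.
rewrite /density card_arcs ler_pdivlMr ?ltr0n ?muln_gt0 ?A0 //.
rewrite -sumE natrD; set a := \sum_(x in A) _; set w := (\sum_(x in A) _)%N.
have l0 : 0 <= lambda by case/andP: l01.
(* As 1/L <= lambda, the wrong pairs are at most a fraction [lambda] of all pairs. *)
have wl : w%:R <= lambda * (a + w)%:R :> R.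
  apply: (@le_trans _ _ (lambda * (L * w)%:R)).
    by rewrite natrM mulrA ler_peMl.
  by rewrite ler_wpM2l // ler_nat sumE.
by rewrite mulrBl mul1r -natrD lerBlDr natrD lerD2l -natrD.
Qed.

Definition has_copy (m : nat) (k t : nat) (T : tournament) (chi : blocks m T)
    (X : 'I_t -> labelled k) : Prop :=
  exists (i : 'I_t) (x : {ffun X i -> T}),
    (forall h, x h \in nth set0 (long_rep chi) (label h)) /\ embedding x.

Lemma nat_inverse (x : R) : 0 < x -> exists n : nat, 1 <= x * n%:R.
Proof.
move=> x0; exists (Num.bound x^-1); rewrite -ler_pdivrMl // mulr1.
by apply/ltW/archi_boundP; rewrite invr_ge0 ltW.
Qed.

(** The property is applied with c1 = 1/C and lambda = 1/L; criticality excludes the strong pair.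
    The thresholds depend on [C] but not on [L], [K] or [T]. *)
Lemma strong_EH_copy (m : nat) (v : m.-tuple bool) (eta : (zeta v m).-tuple nat)
    (t : nat) (X : 'I_t -> labelled (long_length eta)) (C : nat) :
  all (fun a => 0 < a)%N eta -> strong_EH R X -> (0 < C)%N ->
  exists L0 K0, forall (T : tournament) (chi : blocks m T) L K,
    (L0 <= L)%N -> (K0 <= K)%N -> smooth eta L C chi -> critical K T ->
    has_copy chi X.
Proof.
move=> eta0 EHX C0; have c0 : 0 < C%:R^-1 :> R by rewrite invr_gt0 ltr0n.
have [l [c [l0 c20 EH]]] := EHX _ c0.
have [L1 lL1] := nat_inverse l0; have [K1 cK1] := nat_inverse c20.
exists (L1 + 2)%N, (K1 + 2)%N => T chi L K LL KK sm crT.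
have tr0 : (0 < tr T)%N by have [+ _] := crT; lia.
have T0 := leq_trans tr0 (leq_tr_card T).
have L0 : 0 < L%:R :> R by rewrite ltr0n; lia.
have [||//|[A [B sp]]] := EH T L%:R^-1 chi T0.
- rewrite invr_ge0 ler0n /= -(ler_pM2r L0) mulVf ?gt_eqF //.
  by apply: le_trans lL1 _; rewrite ler_pM2l // ler_nat; lia.
- apply: smooth_m_sequence sm => //.
  + by rewrite mulVf // pnatr_eq0 -lt0n.
  + by rewrite invr_ge0 ler0n /= invf_lt1 // ltr1n; lia.
  + by rewrite mulVf ?gt_eqF.
case: (no_strong_pair _ _ crT sp); first by lia.
by apply: le_trans cK1 _; rewrite ler_pM2l // ler_nat; lia.
Qed.

End Reals.
Local Close Scope ring_scope.

(** * Combining two copies *)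

(** Parts are intersected one by one and kept even if empty, so a label designates the same part
    before and after. *)
Definition restrict (m : nat) (T : tournament) (chi : blocks m T)
    (G : 'I_m -> {set T}) : blocks m T :=
  [tuple [seq B :&: G i | B <- tnth chi i] | i < m].

Lemma block_restrict (m : nat) (T : tournament) (chi : blocks m T)
    (G : 'I_m -> {set T}) (i : 'I_m) :
  block (restrict chi G) i \subset block chi i.
Proof.
rewrite /block tnth_mktuple !bigcup_seq; apply/bigcupsP=> _ /mapP[B Bi ->].
exact: subset_trans (subsetIl _ _) (bigcup_sup B Bi).
Qed.

(** Wrong degrees can only decrease while parts lose at most half, so [L] and [C] deteriorate by a
    factor 2. *)
Lemma smooth_restrict (m : nat) (v : m.-tuple bool) (eta : (zeta v m).-tuple nat)
    (T : tournament) (L L' C : nat) (chi : blocks m T) (G : 'I_m -> {set T}) :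
  2 * L' <= L -> smooth eta L C chi ->
  (forall i (B : {set T}), B \in tnth chi i -> #|B| <= 2 * #|B :&: G i|) ->
  smooth eta L' (2 * C) (restrict chi G).
Proof.
move=> LL sm half.
have le i (B : {set T}) t : B \in tnth chi i -> t <= C * #|B| ->
    t <= 2 * C * #|B :&: G i|.
  move=> /half leB /leq_trans; apply; apply: leq_trans (leq_mul (leqnn _) leB) _.
  by rewrite mulnCA mulnA.
split=> [i|i j ne|i vi|i a b|i B vi|i B vi|i j x B ne].
- by rewrite tnth_mktuple size_map (smooth_size sm).
- apply: disjointWl (block_restrict _ _ _) _; apply: disjointWr (block_restrict _ _ _) _.
  exact: smooth_disjoint sm _ _ ne.
- exact: acyclicS (block_restrict _ _ _) (smooth_acyclic sm vi).
- rewrite tnth_mktuple size_map => /andP[ab lb] x y.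
  rewrite !(nth_map set0) ?(ltn_trans ab) // !inE => /andP[xa _] /andP[yb _].
  by apply: (smooth_order sm (i := i) (a := a) (b := b)); rewrite ?ab.
- by rewrite tnth_mktuple => /mapP[D Di ->]; apply: (le) (smooth_part sm vi Di).
- by rewrite tnth_mktuple => /mapP[D Di ->]; apply: (le) (smooth_linear sm vi Di).
- move=> /(subsetP (block_restrict _ _ _)) xi; rewrite tnth_mktuple => /mapP[D Dj ->].
  have leD := leq_trans (smooth_degree sm ne xi Dj) (half _ _ Dj).
  rewrite -(@leq_pmul2l 2) //; apply: leq_trans leD; rewrite mulnA.
  by apply: leq_mul => //; apply: wrong_degreeS; apply: subsetIl.
Qed.

Lemma shape_restrict (m : nat) (T : tournament) (chi : blocks m T)
    (G : 'I_m -> {set T}) : shape (restrict chi G) = shape chi.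
Proof.
rewrite /shape /restrict /= -map_comp -[in RHS](map_tnth_enum chi) -map_comp.
by apply: eq_map => i /=; rewrite size_map.
Qed.

(** The default value is the empty set, so a member certifies that the position decodes to an actual
    part of an actual block. *)
Lemma long_repP (m : nat) (T : tournament) (chi : blocks m T) (n : nat) (y : T) :
  y \in nth set0 (long_rep chi) n ->
  exists i : 'I_m, [/\ reshape_index (shape chi) n = i,
    reshape_offset (shape chi) n < size (tnth chi i)
    & y \in nth set0 (tnth chi i) (reshape_offset (shape chi) n)].
Proof.
rewrite nth_flatten; set r := reshape_index _ _; set c := reshape_offset _ _ => yr.
have rm : r < m.
  rewrite ltnNge; apply/negP=> le; move: yr.
  by rewrite [nth [::] _ _]nth_default ?size_tuple // nth_nil inE.
have E : tnth chi (Ordinal rm) = nth [::] chi r by rewrite (tnth_nth [::]).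
exists (Ordinal rm); rewrite E; split=> //.
by rewrite ltnNge; apply/negP=> le; move: yr; rewrite nth_default // inE.
Qed.

Section Product.
Variables (m : nat) (v : m.-tuple bool) (eta : (zeta v m).-tuple nat).
Variables (T : tournament) (L C : nat) (chi : blocks m T).
Hypothesis smc : smooth eta L C chi.
Variables (k : nat) (X Y : labelled k) (x : X -> T).
Hypothesis xchi : forall h, x h \in nth set0 (long_rep chi) (label h).

Let pos (h : X) : nat := reshape_index (shape chi) (label h).

(* The vertices of the i-th block that agree with the order of the blocks
   towards every vertex of the copy x lying in another block. *)
Definition forward_set (i : 'I_m) : {set T} :=
  [set y | [forall h, (pos h != i) ==> ~~ wrong (pos h) i (x h) y]].

(** Each vertex of the copy excludes at most |B| / L vertices of [B], and there are at most L / 2 of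
    them. *)
Lemma forward_half (i : 'I_m) (B : {set T}) :
  0 < L -> 2 * #|X| <= L -> B \in tnth chi i -> #|B| <= 2 * #|B :&: forward_set i|.
Proof.
move=> L0 XL Bi.
have le : 2 * #|B :\: forward_set i| <= #|B|.
  apply: (@leq_trans (2 * \sum_(h : X | pos h != i) wrong_degree (pos h) i (x h) B)).
    rewrite leq_mul2l /=.
    apply: (@leq_trans #|\bigcup_(h : X | pos h != i)
                           [set y in B | wrong (pos h) i (x h) y]|).
      apply/subset_leq_card/subsetP=> y; rewrite !inE => /andP[+ yB].
      rewrite negb_forall => /existsP[h]; rewrite negb_imply negbK => /andP[ne w].
      by apply/bigcupP; exists h => //; rewrite inE yB.
    apply: leq_trans (leq_card_bigcup _ _ _) _.
    by apply: leq_sum => h _; rewrite card_setIdE.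
  rewrite -(leq_pmul2l L0) mulnCA.
  apply: (@leq_trans (2 * \sum_(h : X) #|B|)); last first.
    by rewrite sum_nat_const mulnA leq_mul2r XL orbT.
  rewrite leq_mul2l /= big_distrr /= big_mkcond /=; apply: leq_sum => h _.
  case: ifP => // ne; have [j [Ej lj xj]] := long_repP (xchi h).
  rewrite /pos Ej; apply: (smooth_degree smc _ _ Bi).
    by rewrite -val_eqE /= -Ej.
  by apply: (subsetP (smooth_piece _)) xj; apply: mem_nth.
by have := cardsID (forward_set i) B; lia.
Qed.

Variable y : Y -> T.
Hypothesis ychi : forall h,
  y h \in nth set0 (long_rep (restrict chi forward_set)) (label h).

(** Positions are ordered lexicographically by block and offset. Between different blocks
    [forward_set] directs the arc; inside one block the completeness between its parts does. *)
Lemma copies_forward (h : X) (h' : Y) :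
  label h != label h' ->
  x h != y h' /\ arc (x h) (y h') = (label h < label h').
Proof.
move=> ne; have [i [Ei li xi]] := long_repP (xchi h).
have [j] := long_repP (ychi h'); rewrite shape_restrict tnth_mktuple size_map.
move=> [Ej lj]; rewrite (nth_map set0) // inE => /andP[yj yG].
have xB := subsetP (smooth_piece (mem_nth set0 li)) _ xi.
have yB := subsetP (smooth_piece (mem_nth set0 lj)) _ yj.
have posE : pos h = i := Ei.
have [E|nij] := eqVneq i j; last first.
  have xy : x h != y h'.
    apply: contraTneq yB => <-.
    have /setP/(_ (x h)) := disjoint_setI0 (smooth_disjoint smc nij).
    by rewrite !inE xB /= => ->.
  split=> //; move: yG; rewrite inE => /forallP/(_ h); rewrite posE nij /wrong /=.
  have nij' : j != i :> nat by rewrite eq_sym.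
  have -> : (label h < label h') = (i < j).
    rewrite ltnNge (reshape_leq (shape chi)) Ei Ej (negbTE nij') orbF -leqNgt.
    by rewrite leq_eqVlt eq_sym (negbTE nij').
  by case: ifP => _ /negbTE // yx; rewrite -[LHS]negbK -arc_tot // yx.
subst j; have smo := smooth_order smc (i := i).
set a := reshape_offset (shape chi) (label h) in li xi.
set b := reshape_offset (shape chi) (label h') in lj yj.
have lt : (label h < label h') = (a < b).
  by rewrite !ltnNge (reshape_leq (shape chi)) Ei Ej ltnn eqxx.
have nab : a != b.
  apply: contra ne => /eqP ab; rewrite -val_eqE eqn_leq.
  rewrite (reshape_leq (shape chi) (label h)) (reshape_leq (shape chi) (label h')).
  by rewrite Ei Ej -/a -/b ab !eqxx !leqnn !orbT.
have neq_arc u w : arc u w -> u != w :> T.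
  by apply: contraTneq => ->; rewrite arc_irr.
rewrite lt; have [ab|ba|E] := ltngtP a b; last by rewrite E eqxx in nab.
  have xy : arc (x h) (y h') by apply: (smo a b) xi yj; rewrite ab.
  by rewrite xy neq_arc.
have yx : arc (y h') (x h) by apply: (smo b a) yj xi; rewrite ba.
by rewrite eq_sym neq_arc // (arc_asym yx).
Qed.

End Product.

Lemma oplus_contained (k : nat) (X Y : labelled k) (o : orthogonal X Y)
    (T : tournament) (x : {ffun X -> T}) (y : {ffun Y -> T}) :
  embedding x -> embedding y ->
  (forall h h', x h != y h' /\ arc (x h) (y h') = (label h < label h')) ->
  contains T (oplus o).
Proof.
move=> /andP[_ /forallP ex] /andP[_ /forallP ey] xy.
(* A labelled tournament is recovered from its labels and backward arcs by the formula of
   [prod_arc]. *)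
have arc_factor (Z : labelled k) (a b : Z) : arc a b =
    if label a < label b then ~~ backward Z b a else backward Z a b.
  rewrite /backward; case: (ltngtP (label a) (label b)) => [ab|ba|E].
  - by rewrite andbT -arc_tot //; apply: contraTneq ab => ->; rewrite ltnn.
  - by rewrite andbT.
  - by rewrite (label_inj (ord_inj E)) arc_irr.
apply: containsP; exists (fun u => match u with inl a => x a | inr b => y b end).
move=> u w; rewrite -[RHS]/(prod_arc u w) /prod_arc; case: u w => [a|a] [b|b] /=.
- by rewrite (eqP (forallP (ex a) b)) arc_factor.
- by have [_ ->] := xy a b; case: ifP.
- have [ne E] := xy b a; rewrite arc_tot // E -leqNgt leq_eqVlt.
  have /negbTE-> : (label a : nat) != label b.
    by apply/eqP=> /ord_inj /esym /o.
  by case: ifP.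
- by rewrite (eqP (forallP (ey a) b)) arc_factor.
Qed.

(** * Regular tournaments satisfy the Erdős-Hajnal conjecture *)

Lemma regular_critical (R : realType) (H : tournament) : regular R H ->
  exists2 K, 0 < K & forall T, critical K T -> contains T H.
Proof.
case=> m [v [eta [s [t [X [Y [o [eta0 EHX EHY ne all_H]]]]]]]].
have [C C0 sm] := smooth_in_critical H eta0.
suff [L [K P]] : exists L K, forall (T : tournament) (chi : blocks m T),
    smooth eta L C chi -> critical K T -> contains T H.
  have [K' crK'] := sm L K; exists K'.+1 => // T crT; apply: contraT => TH.
  have [W [chi [smc crW]]] := crK' T (critical_leq (leqnSn _) crT) TH.
  by rewrite (contains_trans (contains_induced W) (P _ _ smc crW)) in TH.
(* When one family is empty, a copy of a member of the other suffices. *)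
have single (r : nat) (Z : 'I_r -> labelled (long_length eta)) :
    strong_EH R Z -> (forall i, contains (Z i) H) ->
    exists L K, forall (T : tournament) (chi : blocks m T),
      smooth eta L C chi -> critical K T -> contains T H.
  move=> EHZ ZH; have [L [K P]] := strong_EH_copy eta0 EHZ C0.
  exists L, K => T chi smc crT.
  have [i [x [_ ex]]] := P T chi L K (leqnn _) (leqnn _) smc crT.
  by apply: contains_trans (ZH i); apply/existsP; exists x.
move: all_H ne; rewrite /family_prod.
case: eqP => [s0|/eqP s0].
  rewrite all_map => /allP H' ne; case: EHY => [t0|EHY].
    by case: ne; subst t; rewrite enum_ord0.
  by apply: single EHY _ => i; apply: H'; rewrite mem_enum.
case: eqP => [t0|/eqP t0].
  rewrite all_map => /allP H' _; case: EHX => [E|EHX]; first by rewrite E in s0.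
  by apply: single EHX _ => i; apply: H'; rewrite mem_enum.
move=> /all_allpairsP H' _.
case: EHX => [E|EHX]; first by rewrite E in s0.
case: EHY => [E|EHY]; first by rewrite E in t0.
have C20 : 0 < 2 * C by rewrite muln_gt0.
have [L1 [K1 P1]] := strong_EH_copy eta0 EHX C0.
have [L2 [K2 P2]] := strong_EH_copy eta0 EHY C20.
(* [L1] yields the first copy, [2 * L2] survives the halving of the parts, and the sum makes
   [forward_half] applicable whichever [X i] appears. *)
exists (L1 + 2 * L2 + 2 * \sum_i #|X i|).+1, (K1 + K2) => T chi smc crT.
have [||i [x [xchi ex]]] := P1 T chi _ _ _ _ smc crT; [lia|lia|].
have LX : 2 * #|X i| <= (L1 + 2 * L2 + 2 * \sum_i #|X i|).+1.
  by rewrite (bigD1 i) //=; lia.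
have sm' : smooth eta L2 (2 * C) (restrict chi (forward_set chi x)).
  apply: (smooth_restrict _ smc) => [|j B Bj]; first by lia.
  exact: (forward_half smc xchi (ltn0Sn _) LX Bj).
have [||j [y [ychi ey]]] := P2 T _ _ _ _ _ sm' crT; [lia|lia|].
apply: contains_trans (H' i j (mem_enum _ _) (mem_enum _ _)).
apply: oplus_contained ex ey _ => h h'.
apply: (copies_forward smc xchi ychi).
by apply/eqP; apply: o.
Qed.

Theorem theorem12 (R : realType) (H : tournament) :
  regular R H -> satisfies_EH R H.
Proof.
move=> /regular_critical[K K0 crK].
have N0 : 0 < K ^ 2 by rewrite expn_gt0 K0.
have n0 : (0 < (K ^ 2)%:R :> R)%R by rewrite ltr0n.
(* The exponent inverts the bound |T| <= (tr T)^(K^2) of [card_leq_tr]. *)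
exists ((K ^ 2)%:R^-1)%R => [|T TH]; first by rewrite invr_gt0.
have [A acA cA] := tr_witness T; exists A => //.
have := card_leq_tr K0 crK TH; rewrite -cA -(ler_nat R) natrX => le.
apply: (@le_trans _ _ ((#|A|%:R ^+ (K ^ 2)) `^ (K ^ 2)%:R^-1)%R).
  by apply: ge0_ler_powR => //; rewrite ?nnegrE ?exprn_ge0 // invr_ge0 ltW.
by rewrite -powR_mulrn // -powRrM mulfV ?gt_eqF // powRr1.
Qed.
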